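(* With respect to the ordered basis $v^{(2)}_{\mu_1}\otimes v^{(2)}_{\mu_2}$ of $V^{(2)}\otimes V^{(2)}$, with $(\mu_1,\mu_2)$ in the order $$(2,2),(2,0),(2,-2),(0,2),(0,0),(0,-2),(-2,2),(-2,0),(-2,-2)$$ (columns indexed by the input vector, rows by the output vector), the fused $R$-matrix is $$R^{(2,2)}(u)=R^{(2,2)}_0(u)\begin{pmatrix} G&0&A&0&B&0&A&0&H\\ 0&F&0&C&0&C^*&0&D&0\\ A^*&0&G^*&0&B^*&0&H^*&0&A^*\\ 0&C&0&F&0&D&0&C^*&0\\ I&0&I^*&0&E&0&I^*&0&I\\ 0&C^*&0&D&0&F&0&C&0\\ A^*&0&H^*&0&B^*&0&G^*&0&A^*\\ 0&D&0&C^*&0&C&0&F&0\\ H&0&A&0&B&0&A&0&G \end{pmatrix},$$ where $$R^{(2,2)}_0(u)=R^{(2,1)}_0(u-1)R^{(2,1)}_0(u)=\frac{[u+1]}{[u-1]},\qquad R^{(2,1)}_0(u)=R_0(u+1)R_0(u),$$ and, writing $\theta_i(k)=\vartheta_i\left(\frac{k}{2r}\Big|\frac\tau2\right)$ and $\theta_{1,2}(k)=\theta_1(k)\theta_2(k)$, $$A=-\frac{\theta_1(2)\,\theta_2(u)\,\theta_{1,2}(1)\,\theta_{1,2}(u)}{\theta_2(0)^3\theta_2(u+2)\theta_{1,2}(u+1)},\qquad B=-\frac{\theta_2(2)\,\theta_1(u)\,\theta_{1,2}(1)\,\theta_{1,2}(u)}{\theta_2(0)^3\theta_2(u+2)\theta_{1,2}(u+1)},$$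 $$C=\frac{\theta_2(u)^2\theta_{1,2}(2)}{\theta_2(0)^2\theta_{1,2}(u+2)},\qquad D=-\frac{\theta_1(2)^2\theta_{1,2}(u)}{\theta_2(0)^2\theta_{1,2}(u+2)},\qquad F=\frac{\theta_2(2)^2\theta_{1,2}(u)}{\theta_2(0)^2\theta_{1,2}(u+2)},$$ $$E=\frac{\theta_1(2)\theta_{1,2}(1)\left(\theta_2(u+1)^3\theta_2(u-1)+\theta_1(u+1)^3\theta_1(u-1)\right)}{\theta_2(0)^3\theta_{1,2}(u+2)\theta_{1,2}(u+1)}+\frac{\theta_2(2)^2\theta_{1,2}(u)}{\theta_2(0)^2\theta_{1,2}(u+2)},$$ $$G=\frac{\theta_2(u)\left(\theta_1(1)^4\theta_1(u-1)\theta_2(u+1)+\theta_2(1)^4\theta_2(u-1)\theta_1(u+1)\right)}{\theta_2(0)^4\theta_2(u+2)\theta_{1,2}(u+1)},\qquad H=\frac{\theta_1(2)\theta_1(u)^3\theta_{1,2}(1)}{\theta_2(0)^3\theta_2(u+2)\theta_{1,2}(u+1)},$$ $$I=-\frac{\theta_1(2)\left(\theta_2(1)^2\theta_1(u+1)^3\theta_2(u-1)+\theta_1(1)^2\theta_2(u+1)^3\theta_1(u-1)\right)}{\theta_2(0)^3\theta_{1,2}(u+2)\theta_{1,2}(u+1)}-\frac{\theta_1(u)^2\theta_{1,2}(2)}{\theta_2(0)^2\theta_{1,2}(u+2)}.$$ Each starred element is obtained from the corresponding non-starred one by replacing only the theta functions whose argument depends on $u$, according to $\theta_1(u+k)\to-\theta_2(u+k)$,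 $\theta_2(u+k)\to\theta_1(u+k)$ (simultaneously), and leaving the $u$-independent theta functions unchanged.
   Context: Parameters: $K,K',\lambda$ are complex parameters, $x=e^{-\frac{\pi\lambda}{2K}}$, $\tau=\frac{2iK}{K'}$ with $\mathrm{Im}\,\tau>0$, $r=\frac{K'}{\lambda}$, $p=e^{-\pi K'/K}=e^{-2\pi i/\tau}=x^{2r}$, and $|x|<1$. Identities are between meromorphic functions of the spectral parameter $u$. Theta functions: with $\tilde p=e^{2\pi i\tau}$ and $(\tilde p;\tilde p)_\infty=\prod_{n\ge1}(1-\tilde p^n)$, $\vartheta_1(u|\tau)=2\tilde p^{1/8}(\tilde p;\tilde p)_\infty\sin\pi u\prod_{n=1}^\infty(1-2\tilde p^n\cos2\pi u+\tilde p^{2n})$, $\vartheta_2(u|\tau)=\vartheta_1(u+\frac12|\tau)$; in $\vartheta_i(\cdot|\frac{\tau}{2})$ one replaces $\tau$ by $\tau/2$ throughout. The symbol $[u]$ is $[u]=C_0\,\vartheta_1(\frac{u}{r}|\tau)$ with the constant $C_0=x^{-r/4}e^{-\pi i/4}\tau^{1/2}$ (not to be confused with the matrix element $C$). Baxter's $R$-matrix: $V=\mathbb{C}v_+\oplus\mathbb{C}v_-$; $R(u)\in\mathrm{End}(V\otimes V)$ is, in the ordered basis $v_+\otimes v_+,v_+\otimes v_-,v_-\otimes v_+,v_-\otimes v_-$, $$R(u)=R_0(u)\begin{pmatrix}a(u)&0&0&d(u)\\0&b(u)&c(u)&0\\0&c(u)&b(u)&0\\d(u)&0&0&a(u)\end{pmatrix},$$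 where, with $\theta_i(k)=\vartheta_i(\frac{k}{2r}|\frac\tau2)$, $a(u)=\frac{\theta_2(1)\theta_2(u)}{\theta_2(0)\theta_2(1+u)}$, $b(u)=\frac{\theta_2(1)\theta_1(u)}{\theta_2(0)\theta_1(1+u)}$, $c(u)=\frac{\theta_1(1)\theta_2(u)}{\theta_2(0)\theta_1(1+u)}$, $d(u)=-\frac{\theta_1(1)\theta_1(u)}{\theta_2(0)\theta_2(1+u)}$, and with $z=x^{2u}$ (so $z^{s}=x^{2us}$), $(z;x^4,p)_\infty=\prod_{m,n\ge0}(1-zx^{4m}p^n)$, $$R_0(u)=z^{-\frac{r-1}{2r}}\frac{(px^2z;x^4,p)_\infty(x^2z;x^4,p)_\infty(p/z;x^4,p)_\infty(x^4/z;x^4,p)_\infty}{(px^2/z;x^4,p)_\infty(x^2/z;x^4,p)_\infty(pz;x^4,p)_\infty(x^4z;x^4,p)_\infty}.$$ Fusion: $P$ is the flip on $V\otimes V$, $\Pi=\frac12(P+\mathrm{id})$ is the projection on the space $V^{(2)}\subset V\otimes V$ of symmetric tensors, with basis $v^{(2)}_2=v_+\otimes v_+$, $v^{(2)}_0=\frac12(v_+\otimes v_-+v_-\otimes v_+)$, $v^{(2)}_{-2}=v_-\otimes v_-$. Let $V_1,V_2,V_{\bar1},V_{\bar2}$ be copies of $V$; subscripts of an operator indicate the tensor factors on which it acts. Put $R^{(2,1)}_{12,\bar j}(u)=\Pi_{12}R_{1\bar j}(u+1)R_{2\bar j}(u)$, which satisfies $R^{(2,1)}_{12,\bar j}(u)\Pi_{12}=R^{(2,1)}_{12,\bar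 j}(u)$ and is regarded as an operator on $V^{(2)}\otimes V_{\bar j}$. The $2\times2$ fused $R$-matrix is $R^{(2,2)}(u)=\Pi_{\bar1\bar2}R^{(2,1)}_{12,\bar2}(u)R^{(2,1)}_{12,\bar1}(u-1)$, regarded as an operator on $V^{(2)}\otimes V^{(2)}$ (symmetric tensors in $V_1\otimes V_2$, respectively in $V_{\bar1}\otimes V_{\bar2}$). *)

(* Defs.v *)
From Stdlib Require Import Reals List.
From Coquelicot Require Import Coquelicot.
Open Scope C_scope.

Definition Cexp (z : C) : C :=
  (exp (Re z) * cos (Im z), exp (Re z) * sin (Im z))%R.
Definition Ccos (z : C) : C := (Cexp (Ci * z) + Cexp (- (Ci * z))) / 2.
Definition Csin (z : C) : C := (Cexp (Ci * z) - Cexp (- (Ci * z))) / (2 * Ci).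

(* principal branch, nonnegative real part *)
Definition Csqrt (z : C) : C :=
  (sqrt ((Cmod z + Re z) / 2),
   (if Rlt_dec (Im z) 0 then -1 else 1) * sqrt ((Cmod z - Re z) / 2))%R.

Fixpoint Cprod (f : nat -> C) (N : nat) : C :=
  match N with
  | O => 1
  | S n => Cprod f n * f n
  end.

(* f 0 * f 1 * ..., with a junk value when the partial products diverge *)
Definition Cinfprod (f : nat -> C) : C :=
  (real (Lim_seq (fun N => Re (Cprod f N))),
   real (Lim_seq (fun N => Im (Cprod f N)))).

(* The nome is q = exp (2 pi i tau), and q^(1/8) means
   exp (2 pi i tau / 8).  Indices start at 0, hence the exponents n + 1. *)
Definition vartheta1 (v tau : C) : C :=
  let q := Cexp (2 * PI * Ci * tau) in
  2 * Cexp (2 * PI * Ci * tau / 8) * Cinfprod (fun n => 1 - q ^ (n + 1))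
  * Csin (PI * v)
  * Cinfprod (fun n => 1 - 2 * q ^ (n + 1) * Ccos (2 * PI * v)
                       + q ^ (2 * (n + 1))).
Definition vartheta2 (v tau : C) : C := vartheta1 (v + 1 / 2) tau.

Section Baxter.

Context (K K' lam : C).

(* complex powers of x = exp (- pi lam / (2 K)) *)
Definition xpow (s : C) : C := Cexp (- (PI * lam / (2 * K)) * s).
Definition tau : C := 2 * Ci * K / K'.
Definition r_par : C := K' / lam.
Definition p_par : C := Cexp (- (PI * K' / K)).

Definition brC0 : C := xpow (- (r_par / 4)) * Cexp (- (PI * Ci / 4)) * Csqrt tau.
(* [u] *)
Definition br (u : C) : C := brC0 * vartheta1 (u / r_par) tau.

Definition th1 (k : C) : C := vartheta1 (k / (2 * r_par)) (tau / 2).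
Definition th2 (k : C) : C := vartheta2 (k / (2 * r_par)) (tau / 2).

(* (z; x^4, p)_oo *)
Definition qpoch (z : C) : C :=
  Cinfprod (fun m => Cinfprod (fun n => 1 - z * xpow 4 ^ m * p_par ^ n)).

Definition R0_num (u : C) : C :=
  let z := xpow (2 * u) in
  qpoch (p_par * xpow 2 * z) * qpoch (xpow 2 * z) * qpoch (p_par / z)
  * qpoch (xpow 4 / z).
Definition R0_den (u : C) : C :=
  let z := xpow (2 * u) in
  qpoch (p_par * xpow 2 / z) * qpoch (xpow 2 / z) * qpoch (p_par * z)
  * qpoch (xpow 4 * z).
Definition R0 (u : C) : C :=
  xpow (2 * u * - ((r_par - 1) / (2 * r_par))) * (R0_num u / R0_den u).

Definition Ra (u : C) : C := th2 1 * th2 u / (th2 0 * th2 (1 + u)).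
Definition Rb (u : C) : C := th2 1 * th1 u / (th2 0 * th1 (1 + u)).
Definition Rc (u : C) : C := th1 1 * th2 u / (th2 0 * th1 (1 + u)).
Definition Rd (u : C) : C := - (th1 1 * th1 u / (th2 0 * th2 (1 + u))).

(* R(u) without its scalar factor R0 u *)
Definition Rbar_mat (u : C) : @matrix C 4 4 :=
  let a := Ra u in let b := Rb u in let c := Rc u in let d := Rd u in
  let o : C := 0 in
  [[a, o, o, d],
   [o, b, c, o],
   [o, c, b, o],
   [d, o, o, a]].
Definition Rmat (u : C) : @matrix C 4 4 :=
  mk_matrix 4 4 (fun i j => R0 u * coeff_mat (0 : C) (Rbar_mat u) i j).

(* u is not a zero of any of the denominators in the definition of R(u);
   th2 0 <> 0 holds for every tau in the upper half plane *)
Definition R_regular (u : C) : Prop :=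
  th1 (1 + u) <> 0 /\ th2 (1 + u) <> 0 /\ R0_den u <> 0.

End Baxter.

Inductive spin : Set := vp | vm.
Inductive site : Set := s1 | s2 | b1 | b2.

Definition site_eq_dec (i j : site) : {i = j} + {i <> j}.
Proof. decide equality. Defined.

(* v : tensor is the vector whose coordinate on the product of the v_(s i),
   i ranging over the four factors, is v s *)
Definition tensor : Type := (site -> spin) -> C.

Definition upd (s : site -> spin) (i : site) (a : spin) : site -> spin :=
  fun j => if site_eq_dec j i then a else s j.

Definition spin_index (a : spin) : nat :=
  match a with vp => 0 | vm => 1 end.
Definition pair_index (a b : spin) : nat := 2 * spin_index a + spin_index b.

Definition sum_spin (f : spin -> C) : C := f vp + f vm.

(* the operator M, given in the basis ++, +-, -+, --, acting on the factors
   i and j (in this order) *)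
Definition act (M : @matrix C 4 4) (i j : site) (v : tensor) : tensor :=
  fun s => sum_spin (fun a => sum_spin (fun b =>
    coeff_mat (0 : C) M (pair_index (s i) (s j)) (pair_index a b)
    * v (upd (upd s i a) j b))).

Definition flip (i j : site) (v : tensor) : tensor :=
  fun s => v (upd (upd s i (s j)) j (s i)).

Definition Proj (i j : site) (v : tensor) : tensor :=
  fun s => 1 / 2 * (flip i j v s + v s).

(* j is b1 or b2 *)
Definition R21 (K K' lam u : C) (j : site) (v : tensor) : tensor :=
  Proj s1 s2 (act (Rmat K K' lam (u + 1)) s1 j
               (act (Rmat K K' lam u) s2 j v)).

Definition R22 (K K' lam u : C) (v : tensor) : tensor :=
  Proj b1 b2 (R21 K K' lam u b2 (R21 K K' lam (u - 1) b1 v)).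

Definition R21_0 (K K' lam u : C) : C :=
  R0 K K' lam (u + 1) * R0 K K' lam u.
Definition R22_0 (K K' lam u : C) : C :=
  R21_0 K K' lam (u - 1) * R21_0 K K' lam u.

Inductive weight : Set := wt2 | wt0 | wtm2.

(* coordinates of v^(2)_mu in V (x) V; note the 1/2 in v^(2)_0 *)
Definition sym_vec (mu : weight) (a b : spin) : C :=
  match mu, a, b with
  | wt2, vp, vp => 1
  | wt0, vp, vm => 1 / 2
  | wt0, vm, vp => 1 / 2
  | wtm2, vm, vm => 1
  | _, _, _ => 0
  end.

Definition weight_pairs : list (weight * weight) :=
  (wt2, wt2) :: (wt2, wt0) :: (wt2, wtm2)
  :: (wt0, wt2) :: (wt0, wt0) :: (wt0, wtm2)
  :: (wtm2, wt2) :: (wtm2, wt0) :: (wtm2, wtm2) :: nil.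

(* k-th basis vector of V^(2) (x) V^(2), as a vector of the four-fold tensor
   product *)
Definition sym_basis (k : nat) : tensor :=
  let mu := nth k weight_pairs (wt2, wt2) in
  fun s => sym_vec (fst mu) (s s1) (s s2) * sym_vec (snd mu) (s b1) (s b2).

(* T maps V^(2) (x) V^(2) to itself, and its restriction is c times the matrix
   M (columns are inputs) *)
Definition has_sym_matrix (T : tensor -> tensor) (c : C)
    (M : @matrix C 9 9) : Prop :=
  forall j : nat, (j < 9)%nat -> forall s : site -> spin,
    T (sym_basis j) s
    = sum_n (fun i => c * coeff_mat (0 : C) M i j * sym_basis i s) 8.

Definition cmul (g h : C -> C) (k : C) : C := g k * h k.

(* t1 k, t2 k stand for theta_1(k), theta_2(k), and f1 k, f2 k for
   theta_1(u + k), theta_2(u + k).  Keeping them apart allows starring to act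
   on the u-dependent functions only. *)
Definition entA (t1 t2 f1 f2 : C -> C) : C :=
  let t12 := cmul t1 t2 in let f12 := cmul f1 f2 in
  - (t1 2 * f2 0 * t12 1 * f12 0 / (t2 0 ^ 3 * f2 2 * f12 1)).
Definition entB (t1 t2 f1 f2 : C -> C) : C :=
  let t12 := cmul t1 t2 in let f12 := cmul f1 f2 in
  - (t2 2 * f1 0 * t12 1 * f12 0 / (t2 0 ^ 3 * f2 2 * f12 1)).
Definition entC (t1 t2 f1 f2 : C -> C) : C :=
  let t12 := cmul t1 t2 in let f12 := cmul f1 f2 in
  f2 0 ^ 2 * t12 2 / (t2 0 ^ 2 * f12 2).
Definition entD (t1 t2 f1 f2 : C -> C) : C :=
  let f12 := cmul f1 f2 in
  - (t1 2 ^ 2 * f12 0 / (t2 0 ^ 2 * f12 2)).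
Definition entE (t1 t2 f1 f2 : C -> C) : C :=
  let t12 := cmul t1 t2 in let f12 := cmul f1 f2 in
  t1 2 * t12 1 * (f2 1 ^ 3 * f2 (- (1)) + f1 1 ^ 3 * f1 (- (1)))
    / (t2 0 ^ 3 * f12 2 * f12 1)
  + t2 2 ^ 2 * f12 0 / (t2 0 ^ 2 * f12 2).
Definition entF (t1 t2 f1 f2 : C -> C) : C :=
  let f12 := cmul f1 f2 in
  t2 2 ^ 2 * f12 0 / (t2 0 ^ 2 * f12 2).
Definition entG (t1 t2 f1 f2 : C -> C) : C :=
  let f12 := cmul f1 f2 in
  f2 0 * (t1 1 ^ 4 * f1 (- (1)) * f2 1 + t2 1 ^ 4 * f2 (- (1)) * f1 1)
    / (t2 0 ^ 4 * f2 2 * f12 1).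
Definition entH (t1 t2 f1 f2 : C -> C) : C :=
  let t12 := cmul t1 t2 in let f12 := cmul f1 f2 in
  t1 2 * f1 0 ^ 3 * t12 1 / (t2 0 ^ 3 * f2 2 * f12 1).
Definition entI (t1 t2 f1 f2 : C -> C) : C :=
  let t12 := cmul t1 t2 in let f12 := cmul f1 f2 in
  - (t1 2 * (t2 1 ^ 2 * f1 1 ^ 3 * f2 (- (1))
             + t1 1 ^ 2 * f2 1 ^ 3 * f1 (- (1)))
     / (t2 0 ^ 3 * f12 2 * f12 1))
  - f1 0 ^ 2 * t12 2 / (t2 0 ^ 2 * f12 2).

Definition plain (K K' lam u : C)
    (ent : (C -> C) -> (C -> C) -> (C -> C) -> (C -> C) -> C) : C :=
  ent (th1 K K' lam) (th2 K K' lam)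
    (fun k => th1 K K' lam (u + k)) (fun k => th2 K K' lam (u + k)).
Definition starred (K K' lam u : C)
    (ent : (C -> C) -> (C -> C) -> (C -> C) -> (C -> C) -> C) : C :=
  ent (th1 K K' lam) (th2 K K' lam)
    (fun k => - th2 K K' lam (u + k)) (fun k => th1 K K' lam (u + k)).

Definition fused_mat (K K' lam u : C) : @matrix C 9 9 :=
  let e := plain K K' lam u in
  let st := starred K K' lam u in
  let A := e entA in let As := st entA in
  let B := e entB in let Bs := st entB in
  let c := e entC in let cs := st entC in
  let D := e entD in
  let E := e entE in
  let F := e entF in
  let G := e entG in let Gs := st entG in
  let H := e entH in let Hs := st entH in
  let I := e entI in let Is := st entI in
  let o : C := 0 in
  [[G,  o,  A,  o,  B,  o,  A,  o,  H],
   [o,  F,  o,  c,  o,  cs, o,  D,  o],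
   [As, o,  Gs, o,  Bs, o,  Hs, o,  As],
   [o,  c,  o,  F,  o,  D,  o,  cs, o],
   [I,  o,  Is, o,  E,  o,  Is, o,  I],
   [o,  cs, o,  D,  o,  F,  o,  c,  o],
   [As, o,  Hs, o,  Bs, o,  Gs, o,  As],
   [o,  D,  o,  cs, o,  c,  o,  F,  o],
   [H,  o,  A,  o,  B,  o,  A,  o,  G]].

(* Main.v *)
(* Idea.  Up to a constant and a Gaussian, each theta function is a product
   T(v) that is entire, 1-antiperiodic and quasi-periodic under tau.  A
   1-periodic entire function f with f(v + tau) = kap e(-m v) f(v) is determined
   by m consecutive Fourier coefficients, since this relation links the k-th one
   to the (k + m)-th one.  For m = 1 two such functions are proportional, which
   gives Jacobi's imaginary transformation up to a constant; the ratio
   [u + 1] / [u - 1] then becomes a ratio of theta products of nome p and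
   argument x^(2u), which is what the double products in R_0 telescope to.  For m = 2
   three such functions are linearly dependent, so that the antisymmetric kernel
   T(x + y) T(x - y) has rank two and its 4x4 Pfaffians vanish: this is
   Weierstrass' three-term identity.  Its specializations express
   theta_i(u + 2), theta_i(u - 1) and theta_i(2) rationally in theta_i(u),
   theta_i(u + 1), theta_i(1) and theta_2(0), after which each matrix element is
   an identity of rational functions. *)

Require Import Defs.
From Stdlib Require Import Reals List Lra Lia Psatz ZArith.
From Stdlib Require Import FunctionalExtensionality.
From Coquelicot Require Import Coquelicot.
Open Scope C_scope.
Local Arguments Cmod _%_C_scope.

(** * Complex numbers and infinite products *)

(** Neither residues nor counts of zeros occur. The one consequence of holomorphy that carries the
    argument is that a 1-periodic entire function has the same integral over every horizontal unit
    segment; comparing the segments starting at 0 and at [tau] gives the recursion between Fourier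
    coefficients. A Fejer-type kernel shows that the coefficients determine the function. Linear
    dependence is then expressed by vanishing determinants of values, so no zero of a theta function
    has to be located. Jacobi's transformation is forced by the two nomes in play: [[u]] is built on
    [exp (2 pi i tau)], whereas [R_0] is built on [p = exp (- 2 pi i / tau)]. One obstacle remains
    in the addition formulas: the formula for [theta_1 (x + y) theta_1 (x - y)] says nothing at
    [x = y], so [theta_1 (2)] needs a second choice of points in the three-term identity. *)

Lemma C_eq (z w : C) : Re z = Re w -> Im z = Im w -> z = w.
Proof. destruct z, w; simpl; intros; subst; reflexivity. Qed.

Lemma Re_plus (z w : C) : Re (z + w) = (Re z + Re w)%R.
Proof. destruct z, w; reflexivity. Qed.
Lemma Im_plus (z w : C) : Im (z + w) = (Im z + Im w)%R.
Proof. destruct z, w; reflexivity. Qed.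
Lemma Im_mult (z w : C) : Im (z * w) = (Re z * Im w + Im z * Re w)%R.
Proof. destruct z, w; reflexivity. Qed.
Lemma Re_minus (z w : C) : Re (z - w) = (Re z - Re w)%R.
Proof. destruct z, w; reflexivity. Qed.
Lemma Im_minus (z w : C) : Im (z - w) = (Im z - Im w)%R.
Proof. destruct z, w; reflexivity. Qed.

Lemma Im_le_Cmod (z : C) : (Rabs (Im z) <= Cmod z)%R.
Proof.
  eapply Rle_trans; [apply Rmax_r | apply Rmax_Cmod].
Qed.

Lemma Cmod_le_Re_Im (z : C) : (Cmod z <= Rabs (Re z) + Rabs (Im z))%R.
Proof.
  replace z with (RtoC (Re z) + Ci * RtoC (Im z)) at 1
    by (apply C_eq; destruct z; simpl; ring).
  eapply Rle_trans; [apply Cmod_triangle|].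
  rewrite Cmod_mult, Cmod_Ci, !Cmod_R; lra.
Qed.

Lemma Cmod_sub_triangle (z w t : C) :
  (Cmod (z - t) <= Cmod (z - w) + Cmod (w - t))%R.
Proof.
  replace (z - t) with ((z - w) + (w - t)) by ring; apply Cmod_triangle.
Qed.

Lemma Cmod_sub_comm (z w : C) : Cmod (z - w) = Cmod (w - z).
Proof. rewrite <- Cmod_opp; f_equal; ring. Qed.

Lemma Cmod_small_eq (z w : C) :
  (forall eps, (0 < eps)%R -> (Cmod (z - w) <= eps)%R) -> z = w.
Proof.
  intros H.
  assert (H0 : Cmod (z - w) = 0%R).
  { apply Rle_antisym; [|apply Cmod_ge_0].
    apply Rnot_lt_le; intros Hlt.
    specialize (H (Cmod (z - w) / 2)%R ltac:(lra)); lra. }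
  apply Cmod_eq_0 in H0.
  replace z with ((z - w) + w) by ring; rewrite H0; ring.
Qed.

Lemma Cexp_add (z w : C) : Cexp (z + w) = Cexp z * Cexp w.
Proof.
  unfold Cexp; rewrite Re_plus, Im_plus, exp_plus, cos_plus, sin_plus.
  apply C_eq; simpl; ring.
Qed.

Lemma Cexp_0 : Cexp 0 = 1.
Proof.
  unfold Cexp; simpl; rewrite exp_0, cos_0, sin_0; apply C_eq; simpl; ring.
Qed.

Lemma Cexp_neq_0 (z : C) : Cexp z <> 0.
Proof.
  intros H; apply C1_nz.
  rewrite <- Cexp_0; replace (RtoC 0) with (z + - z) by ring.
  rewrite Cexp_add, H; ring.
Qed.

Lemma Cexp_opp (z : C) : Cexp (- z) = / Cexp z.
Proof.
  pose proof (Cexp_neq_0 z) as Hz.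
  replace (Cexp (- z)) with (Cexp z * Cexp (- z) / Cexp z) by (field; exact Hz).
  rewrite <- Cexp_add; replace (z + - z) with (RtoC 0) by ring.
  rewrite Cexp_0; field; exact Hz.
Qed.

Lemma Cexp_pow (z : C) (n : nat) : Cexp z ^ n = Cexp (RtoC (INR n) * z).
Proof.
  induction n as [|n IH].
  - simpl; rewrite Cmult_0_l, Cexp_0; reflexivity.
  - rewrite Cpow_S, IH, <- Cexp_add, S_INR, RtoC_plus; f_equal; ring.
Qed.

Lemma Cmod_Cexp (z : C) : Cmod (Cexp z) = exp (Re z).
Proof.
  unfold Cmod, Cexp; simpl.
  transitivity (sqrt (exp (Re z) * exp (Re z))).
  - f_equal; pose proof (sin2_cos2 (Im z)); unfold Rsqr in *; nra.
  - rewrite sqrt_square; [reflexivity | left; apply exp_pos].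
Qed.

Lemma Cexp_PI : Cexp (PI * Ci) = - (1).
Proof.
  unfold Cexp; simpl.
  replace (PI * 0 - 0 * 1)%R with 0%R by ring.
  replace (PI * 1 + 0 * 0)%R with PI by ring.
  rewrite exp_0, cos_PI, sin_PI; apply C_eq; simpl; ring.
Qed.

(** * Infinite products with geometrically small deviations *)

Lemma Cprod_ext (f g : nat -> C) (N : nat) :
  (forall n, f n = g n) -> Cprod f N = Cprod g N.
Proof. intros H; induction N; simpl; [|rewrite IHN, H]; reflexivity. Qed.

Lemma Cprod_mult (f g : nat -> C) (N : nat) :
  Cprod (fun n => f n * g n) N = Cprod f N * Cprod g N.
Proof. induction N; simpl; [|rewrite IHN]; ring. Qed.

Lemma Cprod_shift (f : nat -> C) (N : nat) :
  Cprod f (S N) = f O * Cprod (fun n => f (S n)) N.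
Proof.
  induction N as [|N IH]; [simpl; ring|].
  change (Cprod f (S (S N))) with (Cprod f (S N) * f (S N)).
  rewrite IH; simpl; ring.
Qed.

Lemma exp_monotone (a b : R) : (a <= b)%R -> (exp a <= exp b)%R.
Proof.
  intros [H| ->]; [left; apply exp_increasing, H | apply Rle_refl].
Qed.

(** Convergence has to be carried separately, since [Cinfprod] also has a value on divergent
    products. Measuring the distance by [Cmod] reduces everything to limits of real sequences. *)
Definition prod_to (f : nat -> C) (L : C) : Prop :=
  is_lim_seq (fun N => Cmod (Cprod f N - L)) 0.

Lemma prod_to_Cinfprod (f : nat -> C) (L : C) :
  prod_to f L -> Cinfprod f = L.
Proof.
  intros H; unfold Cinfprod.
  assert (aux : forall g : C -> R,
    (forall z w, Rabs (g z - g w) <= Cmod (z - w))%R ->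
    is_lim_seq (fun N => g (Cprod f N)) (g L)).
  { intros g Hg.
    apply is_lim_seq_ext with (fun N => (g (Cprod f N) - g L) + g L)%R;
      [intros; ring|].
    replace (Finite (g L)) with (Finite (0 + g L)) by (f_equal; ring).
    apply is_lim_seq_plus'; [|apply is_lim_seq_const].
    apply is_lim_seq_abs_0.
    apply is_lim_seq_le_le with (fun _ => 0%R) (fun N => Cmod (Cprod f N - L)).
    - intros n; split; [apply Rabs_pos | apply Hg].
    - apply is_lim_seq_const.
    - exact H. }
  apply C_eq; simpl.
  - erewrite is_lim_seq_unique;
      [|apply (aux Re); intros; rewrite <- Re_minus; apply re_le_Cmod].
    reflexivity.
  - erewrite is_lim_seq_unique;
      [|apply (aux Im); intros; rewrite <- Im_minus; apply Im_le_Cmod].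
    reflexivity.
Qed.

Lemma prod_to_unique (f : nat -> C) (L L' : C) :
  prod_to f L -> prod_to f L' -> L = L'.
Proof.
  intros H H'.
  rewrite <- (prod_to_Cinfprod _ _ H); apply prod_to_Cinfprod, H'.
Qed.

Lemma prod_to_ext (f g : nat -> C) (L : C) :
  (forall n, f n = g n) -> prod_to f L -> prod_to g L.
Proof.
  intros E; unfold prod_to; apply is_lim_seq_ext.
  intros N; rewrite (Cprod_ext f g) by exact E; reflexivity.
Qed.

Lemma prod_to_mult (f g : nat -> C) (L M : C) :
  prod_to f L -> prod_to g M -> prod_to (fun n => f n * g n) (L * M).
Proof.
  unfold prod_to; intros Hf Hg.
  apply is_lim_seq_le_le with (fun _ => 0%R) (fun N =>
    Cmod (Cprod f N - L) * Cmod (Cprod g N - M)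
    + Cmod (Cprod f N - L) * Cmod M + Cmod L * Cmod (Cprod g N - M))%R.
  - intros N; split; [apply Cmod_ge_0|].
    rewrite Cprod_mult, <- !Cmod_mult.
    replace (Cprod f N * Cprod g N - L * M) with
      ((Cprod f N - L) * (Cprod g N - M) + (Cprod f N - L) * M
       + L * (Cprod g N - M)) by ring.
    eapply Rle_trans; [apply Cmod_triangle|].
    apply Rplus_le_compat_r, Cmod_triangle.
  - apply is_lim_seq_const.
  - replace (Finite 0) with (Finite (0 * 0 + 0 * Cmod M + Cmod L * 0))
      by (f_equal; ring).
    apply is_lim_seq_plus'; [apply is_lim_seq_plus'|].
    + apply is_lim_seq_mult'; assumption.
    + apply is_lim_seq_mult'; [assumption | apply is_lim_seq_const].
    + apply is_lim_seq_mult'; [apply is_lim_seq_const | assumption].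
Qed.

Lemma prod_to_shift (f : nat -> C) (L : C) :
  prod_to (fun n => f (S n)) L -> prod_to f (f O * L).
Proof.
  unfold prod_to; intros H.
  apply is_lim_seq_incr_1.
  apply is_lim_seq_ext with
    (fun N => Cmod (f O) * Cmod (Cprod (fun n => f (S n)) N - L))%R.
  - intros N; rewrite Cprod_shift, <- Cmod_mult; f_equal; ring.
  - replace (Finite 0) with (Finite (Cmod (f O) * 0)) by (f_equal; ring).
    apply is_lim_seq_mult'; [apply is_lim_seq_const | exact H].
Qed.

(** Each factor is at most [1 + B * rho ^ n <= exp (B * rho ^ n)], and the exponents form a finite
    geometric sum. Keeping [1 - rho ^ N] makes the induction exact. *)
Lemma Cprod_geom_bound (f : nat -> C) (B rho : R) (N : nat) :
  (0 <= rho < 1)%R -> (forall n, Cmod (f n - 1) <= B * rho ^ n)%R ->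
  (Cmod (Cprod f N) <= exp (B / (1 - rho) * (1 - rho ^ N)))%R.
Proof.
  intros Hr Hf; induction N as [|N IH]; simpl.
  - rewrite Cmod_1; replace (B / (1 - rho) * (1 - 1))%R with 0%R by ring.
    rewrite exp_0; lra.
  - rewrite Cmod_mult.
    replace (B / (1 - rho) * (1 - rho * rho ^ N))%R with
      (B / (1 - rho) * (1 - rho ^ N) + B * rho ^ N)%R by (field; lra).
    rewrite exp_plus.
    apply Rmult_le_compat; try apply Cmod_ge_0; [exact IH|].
    replace (f N) with ((f N - 1) + 1) by ring.
    eapply Rle_trans; [apply Cmod_triangle|]; rewrite Cmod_1.
    eapply Rle_trans; [|apply exp_ineq1_le]; specialize (Hf N); lra.
Qed.

(** A bound for all partial products times the sum of all deviations [B * rho ^ n]. *)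
Definition geom_const (B rho : R) : R :=
  (exp (B / (1 - rho)) * (B / (1 - rho)))%R.

Lemma geom_const_pos (B rho : R) :
  (0 <= rho < 1)%R -> (0 <= B)%R -> (0 <= geom_const B rho)%R.
Proof.
  intros Hr HB; apply Rmult_le_pos; [left; apply exp_pos|].
  apply Rdiv_le_0_compat; lra.
Qed.

(** Consecutive partial products differ by [Cprod f n * (f n - 1)]; the right-hand side telescopes
    along with them. *)
Lemma Cprod_geom_cauchy (f : nat -> C) (B rho : R) (N k : nat) :
  (0 <= rho < 1)%R -> (0 <= B)%R ->
  (forall n, Cmod (f n - 1) <= B * rho ^ n)%R ->
  (Cmod (Cprod f (N + k) - Cprod f N)
   <= geom_const B rho * (rho ^ N - rho ^ (N + k)))%R.
Proof.
  intros Hr HB Hf; induction k as [|k IH].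
  - rewrite Nat.add_0_r.
    replace (Cprod f N - Cprod f N) with (RtoC 0) by ring.
    rewrite Cmod_0; lra.
  - replace (N + S k)%nat with (S (N + k)) by lia; simpl.
    replace (Cprod f (N + k) * f (N + k)%nat - Cprod f N) with
      (Cprod f (N + k) * (f (N + k)%nat - 1) + (Cprod f (N + k) - Cprod f N))
      by ring.
    eapply Rle_trans; [apply Cmod_triangle|].
    rewrite Cmod_mult.
    assert (H1 : (Cmod (Cprod f (N + k)) <= exp (B / (1 - rho)))%R).
    { eapply Rle_trans; [apply (Cprod_geom_bound f B rho); assumption|].
      assert (0 <= B / (1 - rho))%R by (apply Rdiv_le_0_compat; lra).
      assert (0 <= rho ^ (N + k))%R by (apply pow_le; lra).
      apply exp_monotone; nra. }
    assert (H2 : (Cmod (Cprod f (N + k)) * Cmod (f (N + k)%nat - 1)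
                  <= exp (B / (1 - rho)) * (B * rho ^ (N + k)))%R).
    { apply Rmult_le_compat; try apply Cmod_ge_0; [exact H1 | apply Hf]. }
    replace (geom_const B rho * (rho ^ N - rho * rho ^ (N + k)))%R with
      (exp (B / (1 - rho)) * (B * rho ^ (N + k))
       + geom_const B rho * (rho ^ N - rho ^ (N + k)))%R
      by (unfold geom_const; field; lra).
    lra.
Qed.

(** The rate depends on [f] only through [B] and [rho], which later makes the convergence locally
    uniform in a parameter. *)
Lemma Cprod_geom_cv (f : nat -> C) (B rho : R) :
  (0 <= rho < 1)%R -> (0 <= B)%R ->
  (forall n, Cmod (f n - 1) <= B * rho ^ n)%R ->
  prod_to f (Cinfprod f) /\
  forall N, (Cmod (Cprod f N - Cinfprod f) <= geom_const B rho * rho ^ N)%R.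
Proof.
  intros Hr HB Hf.
  pose proof (geom_const_pos B rho Hr HB) as HA.
  set (A := geom_const B rho) in *.
  assert (Hgeo : is_lim_seq (fun N => A * rho ^ N)%R 0).
  { replace (Finite 0) with (Finite (A * 0)) by (f_equal; ring).
    apply is_lim_seq_mult'; [apply is_lim_seq_const|].
    apply is_lim_seq_geom; rewrite Rabs_pos_eq; lra. }
  assert (Hc : forall N M, (N <= M)%nat ->
    (Cmod (Cprod f M - Cprod f N) <= A * rho ^ N)%R).
  { intros N M HNM; replace M with (N + (M - N))%nat by lia.
    eapply Rle_trans; [apply (Cprod_geom_cauchy f B rho); assumption|].
    fold A; assert (0 <= rho ^ (N + (M - N)))%R by (apply pow_le; lra); nra. }
  assert (Hex : forall g : C -> R,
    (forall z w, Rabs (g z - g w) <= Cmod (z - w))%R ->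
    ex_finite_lim_seq (fun N => g (Cprod f N))).
  { intros g Hg; apply ex_lim_seq_cauchy_corr; intros eps.
    apply is_lim_seq_spec in Hgeo; destruct (Hgeo eps) as [N0 HN0].
    exists N0; intros n m Hn Hm.
    assert (K : forall a b, (N0 <= a)%nat -> (a <= b)%nat ->
      (Rabs (g (Cprod f b) - g (Cprod f a)) < eps)%R).
    { intros a b Ha Hab; eapply Rle_lt_trans; [apply Hg|].
      eapply Rle_lt_trans; [apply Hc; exact Hab|].
      specialize (HN0 a Ha); rewrite Rminus_0_r in HN0.
      eapply Rle_lt_trans; [apply Rle_abs | exact HN0]. }
    destruct (Nat.le_ge_cases m n).
    - apply K; assumption.
    - rewrite Rabs_minus_sym; apply K; assumption. }
  destruct (Hex Re) as [lr Hlr].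
  { intros; rewrite <- Re_minus; apply re_le_Cmod. }
  destruct (Hex Im) as [li Hli].
  { intros; rewrite <- Im_minus; apply Im_le_Cmod. }
  assert (HL : prod_to f (lr, li)).
  { unfold prod_to.
    apply is_lim_seq_le_le with (fun _ => 0%R) (fun N =>
      Rabs (Re (Cprod f N) - lr) + Rabs (Im (Cprod f N) - li))%R.
    - intros N; split; [apply Cmod_ge_0|].
      eapply Rle_trans; [apply Cmod_le_Re_Im|].
      rewrite Re_minus, Im_minus; simpl; lra.
    - apply is_lim_seq_const.
    - replace (Finite 0) with (Finite (Rabs (lr - lr) + Rabs (li - li)))
        by (f_equal; rewrite !Rminus_diag, Rabs_R0; ring).
      apply is_lim_seq_plus';
        [apply (is_lim_seq_abs _ (Finite (lr - lr)))
        |apply (is_lim_seq_abs _ (Finite (li - li)))];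
        apply is_lim_seq_minus'; auto using is_lim_seq_const. }
  rewrite (prod_to_Cinfprod _ _ HL); split; [exact HL|].
  (* If the bound failed by [d], a later partial product within [d] of the limit would violate
     [Hc]. *)
  intros N; apply Rnot_lt_le; intros Hlt.
  set (d := (Cmod (Cprod f N - (lr, li)) - A * rho ^ N)%R).
  assert (Hd : (0 < d)%R) by (unfold d; lra).
  apply is_lim_seq_spec in HL.
  destruct (HL (mkposreal d Hd)) as [N1 HN1]; simpl in HN1.
  specialize (HN1 (max N N1) ltac:(lia)).
  rewrite Rminus_0_r, Rabs_pos_eq in HN1 by apply Cmod_ge_0.
  pose proof (Hc N (max N N1) ltac:(lia)) as H2.
  pose proof (Cmod_sub_triangle (Cprod f N) (Cprod f (max N N1)) (lr, li)).
  rewrite (Cmod_sub_comm (Cprod f N) (Cprod f (max N N1))) in H.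
  unfold d in HN1; lra.
Qed.

(** * The theta function in product form *)

Lemma RtoC_neq_0 (x : R) : x <> 0%R -> RtoC x <> 0.
Proof. intros H E; apply H; injection E; auto. Qed.

Lemma C2_neq_0 : RtoC 2 <> 0.
Proof. apply RtoC_neq_0; lra. Qed.

Lemma Ci_neq_0 : Ci <> 0.
Proof. intros E; injection E; lra. Qed.

Lemma Ci_sqr : Ci * Ci = - (1).
Proof. apply C_eq; simpl; ring. Qed.

Definition cis (s : C) : C := Cexp (2 * PI * Ci * s).

Lemma cis_add (s t : C) : cis (s + t) = cis s * cis t.
Proof. unfold cis; rewrite <- Cexp_add; f_equal; ring. Qed.
Lemma cis_0 : cis 0 = 1.
Proof. unfold cis; rewrite Cmult_0_r; apply Cexp_0. Qed.
Lemma cis_neq_0 (s : C) : cis s <> 0.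
Proof. apply Cexp_neq_0. Qed.
Lemma cis_opp (s : C) : cis (- s) = / cis s.
Proof. unfold cis; rewrite <- Cexp_opp; f_equal; ring. Qed.
Lemma cis_half : cis (1 / 2) = - (1).
Proof.
  unfold cis; rewrite <- Cexp_PI; f_equal; field.
Qed.
Lemma cis_1 : cis 1 = 1.
Proof.
  replace (RtoC 1) with (1 / 2 + 1 / 2) at 1 by field.
  rewrite cis_add, cis_half; ring.
Qed.
Lemma Cmod_cis (s : C) : Cmod (cis s) = exp (- (2 * PI * Im s)).
Proof.
  unfold cis; rewrite Cmod_Cexp; f_equal; destruct s; simpl; ring.
Qed.

Definition qprod (q z : C) : C := Cinfprod (fun n => 1 - z * q ^ n).

Lemma qprod_cv (q z : C) : (Cmod q < 1)%R ->
  prod_to (fun n => 1 - z * q ^ n) (qprod q z) /\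
  forall N, (Cmod (Cprod (fun n => 1 - z * q ^ n)%C N - qprod q z)
             <= geom_const (Cmod z) (Cmod q) * Cmod q ^ N)%R.
Proof.
  intros Hq; apply Cprod_geom_cv.
  - split; [apply Cmod_ge_0 | exact Hq].
  - apply Cmod_ge_0.
  - intros n.
    replace (1 - z * q ^ n - 1) with (- (z * q ^ n)) by ring.
    rewrite Cmod_opp, Cmod_mult, Cmod_pow; apply Rle_refl.
Qed.

Lemma qprod_step (q z : C) : (Cmod q < 1)%R ->
  qprod q z = (1 - z) * qprod q (z * q).
Proof.
  intros Hq; apply prod_to_Cinfprod.
  replace (1 - z) with (1 - z * q ^ 0) by (simpl; ring).
  apply (prod_to_shift (fun n => 1 - z * q ^ n)).
  apply prod_to_ext with (fun n => 1 - (z * q) * q ^ n).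
  - intros n; rewrite Cpow_S; ring.
  - apply qprod_cv, Hq.
Qed.

(** The multiplicative theta function: Jacobi's triple product without its constant factor
    [(q; q)]. *)
Definition jtheta (q z : C) : C := qprod q z * qprod q (q / z).

(** Passing from [z] to [q * z] removes the factor [1 - z] from one product and adds [1 - / z] to
    the other; their quotient is [- / z]. *)
Lemma jtheta_mul (q z : C) : (Cmod q < 1)%R -> q <> 0 -> z <> 0 ->
  jtheta q (q * z) = - jtheta q z / z.
Proof.
  intros Hq Hq0 Hz; unfold jtheta.
  replace (q / (q * z)) with (/ z) by (field; auto).
  rewrite (qprod_step q (/ z)), (qprod_step q z) by exact Hq.
  rewrite (Cmult_comm q z); unfold Cdiv; rewrite (Cmult_comm q (/ z)).
  field; exact Hz.
Qed.

Lemma jtheta_inv (q z : C) : (Cmod q < 1)%R -> q <> 0 -> z <> 0 ->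
  jtheta q (/ z) = - jtheta q z / z.
Proof.
  intros Hq Hq0 Hz; rewrite <- jtheta_mul by assumption; unfold jtheta.
  rewrite Cmult_comm; f_equal; f_equal; field; auto.
Qed.

(** The factor [cis (- v / 2)] makes the function odd and 1-antiperiodic; it is [vartheta1] up to a
    factor that depends on [tau] alone. *)
Definition nome_theta (tau v : C) : C :=
  cis (- v / 2) * jtheta (cis tau) (cis v).

Lemma Cmod_cis_lt_1 (tau : C) : (0 < Im tau)%R -> (Cmod (cis tau) < 1)%R.
Proof.
  intros H; rewrite Cmod_cis, <- exp_0; apply exp_increasing.
  pose proof PI_RGT_0; nra.
Qed.

Section Nome_theta.

Variable tau : C.
Hypothesis Htau : (0 < Im tau)%R.

Lemma nome_theta_add1 (v : C) : nome_theta tau (v + 1) = - nome_theta tau v.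
Proof.
  unfold nome_theta; rewrite (cis_add v), cis_1, Cmult_1_r.
  replace (- (v + 1) / 2) with (- v / 2 + - (1 / 2)) by field.
  rewrite cis_add, cis_opp, cis_half; field.
Qed.

Lemma nome_theta_opp (v : C) : nome_theta tau (- v) = - nome_theta tau v.
Proof.
  unfold nome_theta; rewrite (cis_opp v).
  rewrite jtheta_inv; auto using Cmod_cis_lt_1, cis_neq_0.
  replace (cis (- - v / 2)) with (cis (- v / 2) * cis v).
  - field; apply cis_neq_0.
  - rewrite <- cis_add; f_equal; field.
Qed.

Lemma nome_theta_addtau (v : C) :
  nome_theta tau (v + tau) = - cis (- v - tau / 2) * nome_theta tau v.
Proof.
  unfold nome_theta; rewrite (Cplus_comm v tau), (cis_add tau v).
  rewrite jtheta_mul; auto using Cmod_cis_lt_1, cis_neq_0.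
  replace (cis (- (tau + v) / 2)) with
    (cis (- v - tau / 2) * cis (- v / 2) * cis v).
  - field; apply cis_neq_0.
  - rewrite <- !cis_add; f_equal; field.
Qed.

Definition vartheta1_const : C :=
  Ci * Cexp (2 * PI * Ci * tau / 8)
  * Cinfprod (fun n => 1 - cis tau ^ (n + 1)).

(** The product in [vartheta1] starts at exponent 1; the sine supplies the missing factor
    [1 - cis v], together with [cis (- v / 2)] and the [Ci] of the constant. *)
Lemma vartheta1_nome_theta (v : C) :
  vartheta1 v tau = vartheta1_const * nome_theta tau v.
Proof.
  assert (Hq := Cmod_cis_lt_1 tau Htau).
  unfold vartheta1, vartheta1_const, nome_theta, jtheta.
  fold (cis tau); set (q := cis tau) in *.
  assert (Hcos : Ccos (2 * PI * v) = (cis v + / cis v) / 2).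
  { unfold Ccos; rewrite <- cis_opp; unfold cis; do 3 f_equal; ring. }
  assert (Hsin : Csin (PI * v) = Ci / 2 * cis (- v / 2) * (1 - cis v)).
  { unfold Csin.
    replace (Ci * (PI * v)) with (2 * PI * Ci * (- v / 2) + 2 * PI * Ci * v)
      at 1 by field.
    replace (- (Ci * (PI * v))) with (2 * PI * Ci * (- v / 2))
      by field.
    rewrite Cexp_add; fold (cis (- v / 2)) (cis v).
    replace (Ci / 2) with (Ci * Ci / (2 * Ci))
      by (field; apply Ci_neq_0).
    rewrite Ci_sqr; field; apply Ci_neq_0. }
  assert (Hprod : Cinfprod (fun n => 1 - 2 * q ^ (n + 1) * Ccos (2 * PI * v)
                              + q ^ (2 * (n + 1)))
                  = qprod q (cis v * q) * qprod q (q / cis v)).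
  { apply prod_to_Cinfprod.
    apply prod_to_ext with (fun n => (1 - (cis v * q) * q ^ n)
                                     * (1 - q / cis v * q ^ n)).
    - intros n; rewrite Hcos.
      replace (2 * (n + 1))%nat with ((n + 1) + (n + 1))%nat by lia.
      rewrite !Cpow_add_r, Cpow_1_r; field.
      apply cis_neq_0.
    - apply prod_to_mult; apply qprod_cv, Hq. }
  rewrite Hprod, Hsin, (qprod_step q (cis v)) by exact Hq.
  field.
Qed.

End Nome_theta.

(** * Entire functions *)

Lemma exp_sub1_bound (a : R) : (Rabs (exp a - 1) <= Rabs a * exp (Rabs a))%R.
Proof.
  pose proof (exp_ineq1_le a) as H1; pose proof (exp_ineq1_le (- a)) as H2.
  pose proof (exp_pos a) as H3.
  assert (H4 : (exp a * exp (- a) = 1)%R)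
    by (rewrite <- exp_plus, Rplus_opp_r; apply exp_0).
  assert (H5 : (exp a - 1 <= a * exp a)%R) by nra.
  destruct (Rle_or_lt 0 a) as [Ha | Ha].
  - rewrite !Rabs_pos_eq by lra; exact H5.
  - rewrite !Rabs_left1 by nra.
    assert (1 <= exp (- a))%R by lra; nra.
Qed.

Lemma exp_sub2_bound (a : R) :
  (Rabs (exp a - 1 - a) <= a ^ 2 * exp (Rabs a))%R.
Proof.
  pose proof (exp_ineq1_le a) as H1; pose proof (exp_ineq1_le (- a)) as H2.
  pose proof (exp_pos a) as H3.
  assert (H4 : (exp a * exp (- a) = 1)%R)
    by (rewrite <- exp_plus, Rplus_opp_r; apply exp_0).
  assert (H5 : (exp a - 1 <= a * exp a)%R) by nra.
  rewrite Rabs_pos_eq by lra.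
  pose proof (exp_sub1_bound a) as H6.
  apply Rle_trans with (a * (exp a - 1))%R; [lra|].
  apply Rle_trans with (Rabs a * Rabs (exp a - 1))%R.
  - rewrite <- Rabs_mult; apply Rle_abs.
  - rewrite <- (pow2_abs a); pose proof (Rabs_pos a); nra.
Qed.

Lemma sin_abs_bound (x : R) : (Rabs (sin x) <= Rabs x)%R.
Proof.
  assert (aux : forall y, (0 <= y -> sin y <= y /\ - y <= sin y)%R).
  { intros y [Hy | <-]; [|rewrite sin_0; lra].
    destruct (Rlt_or_le y PI) as [H | H].
    - pose proof (sin_lt_x y Hy); pose proof (sin_gt_0 y Hy H); lra.
    - pose proof (SIN_bound y); pose proof PI2_1; lra. }
  destruct (Rle_or_lt 0 x) as [H | H].
  - rewrite (Rabs_pos_eq x H); apply Rabs_le; destruct (aux x H); lra.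
  - rewrite (Rabs_left x H); apply Rabs_le.
    destruct (aux (- x)%R ltac:(lra)) as [H1 H2]; rewrite sin_neg in H1, H2.
    lra.
Qed.

Lemma cos_sub1_bound (x : R) : (Rabs (cos x - 1) <= x ^ 2 / 2)%R.
Proof.
  replace x with (2 * (x / 2))%R at 1 by field.
  rewrite cos_2a_sin.
  pose proof (sin_abs_bound (x / 2)) as H.
  apply Rsqr_le_abs_1 in H; unfold Rsqr in H.
  rewrite Rabs_left1; nra.
Qed.

Lemma sin_sub_bound (x : R) : (Rabs (sin x - x) <= x ^ 2)%R.
Proof.
  destruct (MVT_gen (fun t => sin t - t)%R 0 x (fun t => cos t - 1)%R)
    as [c [Hc1 Hc2]].
  - intros t _; auto_derive; [exact I | ring].
  - intros t _; apply continuity_pt_minus;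
      [apply continuity_sin | apply derivable_continuous_pt, derivable_pt_id].
  - rewrite sin_0, !Rminus_0_r in Hc2; rewrite Hc2, Rabs_mult, <- pow2_abs.
    assert (Hc : (Rabs c <= Rabs x)%R).
    { unfold Rmin, Rmax in Hc1; destruct (Rle_dec 0 x);
        apply Rabs_le; [rewrite Rabs_pos_eq | rewrite Rabs_left1]; lra. }
    assert (H : (Rabs (cos c - 1) <= Rabs c)%R).
    { pose proof (cos_sub1_bound c) as H1; pose proof (COS_bound c) as H2.
      rewrite <- pow2_abs in H1; pose proof (Rabs_pos c).
      destruct (Rle_or_lt (Rabs c) 2); [nra|].
      rewrite Rabs_left1; lra. }
    pose proof (Rabs_pos x); pose proof (Rabs_pos c); nra.
Qed.

Lemma Cexp_sub2_bound (w : C) :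
  (Cmod (Cexp w - 1 - w) <= 4 * exp (Cmod w) * Cmod w ^ 2)%R.
Proof.
  pose proof (re_le_Cmod w) as Ha; pose proof (Im_le_Cmod w) as Hb.
  pose proof (Cmod_ge_0 w) as Hm.
  set (m := Cmod w) in *; set (a := Re w) in *; set (b := Im w) in *.
  assert (Hea : (exp (Rabs a) <= exp m)%R) by (apply exp_monotone, Ha).
  assert (He1 : (1 + m <= exp m)%R) by apply exp_ineq1_le.
  assert (Ha2 : (a ^ 2 <= m ^ 2)%R)
    by (rewrite <- pow2_abs; pose proof (Rabs_pos a); nra).
  assert (Hb2 : (b ^ 2 <= m ^ 2)%R)
    by (rewrite <- pow2_abs; pose proof (Rabs_pos b); nra).
  assert (Hm2 : (0 <= m ^ 2)%R) by nra.
  pose proof (exp_pos (Rabs a)) as Hp.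
  pose proof (exp_sub2_bound a) as E2; pose proof (exp_sub1_bound a) as E1.
  pose proof (cos_sub1_bound b) as Cb; pose proof (sin_sub_bound b) as Sb.
  pose proof (sin_abs_bound b) as Sa.
  assert (Cl : (Rabs (cos b) <= 1)%R)
    by (apply Rabs_le; pose proof (COS_bound b); lra).
  eapply Rle_trans; [apply Cmod_le_Re_Im|].
  rewrite !Re_minus, !Im_minus.
  change (Re (Cexp w)) with (exp a * cos b)%R.
  change (Im (Cexp w)) with (exp a * sin b)%R.
  change (Re 1) with 1%R; change (Im 1) with 0%R.
  fold a b.
  (* Real and imaginary parts split into four pieces, each at most [exp m * m ^ 2]; hence the
     constant 4. *)
  replace (exp a * cos b - 1 - a)%R with
    ((exp a - 1 - a) * cos b + (1 + a) * (cos b - 1))%R by ring.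
  replace (exp a * sin b - 0 - b)%R with
    ((exp a - 1) * sin b + (sin b - b))%R by ring.
  assert (X1 : (Rabs ((exp a - 1 - a) * cos b) <= m ^ 2 * exp m)%R).
  { rewrite Rabs_mult; rewrite <- (Rmult_1_r (m ^ 2 * exp m)).
    apply Rmult_le_compat; try apply Rabs_pos; [|exact Cl].
    eapply Rle_trans; [exact E2|].
    apply Rmult_le_compat; try lra; apply pow2_ge_0. }
  assert (X2 : (Rabs ((1 + a) * (cos b - 1)) <= exp m * m ^ 2)%R).
  { rewrite Rabs_mult.
    apply Rmult_le_compat; try apply Rabs_pos; [|lra].
    eapply Rle_trans; [apply Rabs_triang|]; rewrite Rabs_R1; lra. }
  assert (X3 : (Rabs ((exp a - 1) * sin b) <= m * exp m * m)%R).
  { rewrite Rabs_mult.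
    apply Rmult_le_compat; try apply Rabs_pos; [|lra].
    eapply Rle_trans; [exact E1|].
    apply Rmult_le_compat; try lra; apply Rabs_pos. }
  assert (X4 : (Rabs (sin b - b) <= exp m * m ^ 2)%R).
  { eapply Rle_trans; [exact Sb|]; nra. }
  pose proof (Rabs_triang ((exp a - 1 - a) * cos b) ((1 + a) * (cos b - 1))).
  pose proof (Rabs_triang ((exp a - 1) * sin b) (sin b - b)).
  nra.
Qed.

(** Differentiability with a quadratic remainder, uniform on every disc and for steps of length at
    most 1. In this quantitative form, closure under products and exponentials and the Lipschitz
    continuity of [f'] are elementary estimates that need no integral formula. *)
Definition hol_deriv (f f' : C -> C) : Prop :=
  forall r : R, exists M : R, (0 <= M)%R /\
    forall v h, (Cmod v <= r)%R -> (Cmod h <= 1)%R ->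
      (Cmod (f v) <= M)%R /\ (Cmod (f' v) <= M)%R /\
      (Cmod (f (v + h) - f v - h * f' v)%C <= M * Cmod h ^ 2)%R.

Definition hol (f : C -> C) : Prop := exists f', hol_deriv f f'.

Lemma hol_const (c : C) : hol (fun _ => c).
Proof.
  exists (fun _ => 0); intros r; exists (Cmod c); split; [apply Cmod_ge_0|].
  intros v h _ _; pose proof (Cmod_ge_0 c); repeat split.
  - lra.
  - rewrite Cmod_0; lra.
  - replace (c - c - h * 0) with (RtoC 0) by ring; rewrite Cmod_0.
    pose proof (pow2_ge_0 (Cmod h)); nra.
Qed.

Lemma hol_id : hol (fun v => v).
Proof.
  exists (fun _ => 1); intros r; exists (Rabs r + 1)%R.
  pose proof (Rle_abs r); pose proof (Rabs_pos r).
  split; [lra|].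
  intros v h Hv _; repeat split.
  - lra.
  - rewrite Cmod_1; lra.
  - replace (v + h - v - h * 1) with (RtoC 0) by ring; rewrite Cmod_0.
    pose proof (pow2_ge_0 (Cmod h)); nra.
Qed.

Lemma hol_plus (f g : C -> C) : hol f -> hol g -> hol (fun v => f v + g v).
Proof.
  intros [f' Hf] [g' Hg]; exists (fun v => f' v + g' v); intros r.
  destruct (Hf r) as [M [HM Kf]], (Hg r) as [N [HN Kg]].
  exists (M + N)%R; split; [lra|]; intros v h Hv Hh.
  destruct (Kf v h Hv Hh) as [A1 [A2 A3]], (Kg v h Hv Hh) as [B1 [B2 B3]].
  repeat split.
  - eapply Rle_trans; [apply Cmod_triangle | lra].
  - eapply Rle_trans; [apply Cmod_triangle | lra].
  - replace (f (v + h) + g (v + h) - (f v + g v) - h * (f' v + g' v)) with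
      ((f (v + h) - f v - h * f' v) + (g (v + h) - g v - h * g' v)) by ring.
    eapply Rle_trans; [apply Cmod_triangle | lra].
Qed.

Lemma hol_deriv_near (f f' : C -> C) (M : R) (v h : C) :
  (Cmod h <= 1)%R -> (0 <= M)%R -> (Cmod (f' v) <= M)%R ->
  (Cmod (f (v + h) - f v - h * f' v)%C <= M * Cmod h ^ 2)%R ->
  (Cmod (f (v + h) - f v)%C <= 2 * M * Cmod h)%R.
Proof.
  intros Hh HM H1 H2.
  replace (f (v + h) - f v) with ((f (v + h) - f v - h * f' v) + h * f' v)
    by ring.
  eapply Rle_trans; [apply Cmod_triangle|]; rewrite Cmod_mult.
  pose proof (Cmod_ge_0 h).
  assert (Cmod h * Cmod (f' v) <= Cmod h * M)%R
    by (apply Rmult_le_compat_l; assumption).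
  assert (M * Cmod h ^ 2 <= M * Cmod h)%R
    by (apply Rmult_le_compat_l; [exact HM | nra]).
  lra.
Qed.

Lemma hol_mult (f g : C -> C) : hol f -> hol g -> hol (fun v => f v * g v).
Proof.
  intros [f' Hf] [g' Hg]; exists (fun v => f' v * g v + f v * g' v); intros r.
  destruct (Hf r) as [M [HM Kf]], (Hg r) as [N [HN Kg]].
  assert (HMN : (0 <= M * N)%R) by (apply Rmult_le_pos; assumption).
  exists (6 * (M * N))%R; split; [lra|]; intros v h Hv Hh.
  destruct (Kf v h Hv Hh) as [A1 [A2 A3]], (Kg v h Hv Hh) as [B1 [B2 B3]].
  assert (P : forall a b A B : R, (0 <= a -> 0 <= b -> a <= A -> b <= B ->
    a * b <= A * B)%R) by (intros; apply Rmult_le_compat; assumption).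
  pose proof (Cmod_ge_0 h) as Hh0.
  assert (Hh2 : (0 <= Cmod h ^ 2)%R) by apply pow2_ge_0.
  repeat split.
  - rewrite Cmod_mult.
    pose proof (P _ _ _ _ (Cmod_ge_0 (f v)) (Cmod_ge_0 (g v)) A1 B1); lra.
  - eapply Rle_trans; [apply Cmod_triangle|]; rewrite !Cmod_mult.
    pose proof (P _ _ _ _ (Cmod_ge_0 (f' v)) (Cmod_ge_0 (g v)) A2 B1).
    pose proof (P _ _ _ _ (Cmod_ge_0 (f v)) (Cmod_ge_0 (g' v)) A1 B2); lra.
  - set (a := f (v + h) - f v - h * f' v) in *.
    set (b := g (v + h) - g v - h * g' v) in *.
    (* Six terms, each at most [M * N * Cmod h ^ 2], which explains the constant 6. *)
    replace (f (v + h) * g (v + h) - f v * g v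
             - h * (f' v * g v + f v * g' v)) with
      (h * h * (f' v * g' v) + f v * b + h * (f' v * b) + a * g v
       + h * (a * g' v) + a * b) by (unfold a, b; ring).
    assert (T : forall t, (0 <= t -> Cmod h * t <= t)%R) by (intros; nra).
    assert (X1 : (Cmod (h * h * (f' v * g' v)) <= M * N * Cmod h ^ 2)%R).
    { rewrite !Cmod_mult.
      pose proof (P _ _ _ _ (Cmod_ge_0 (f' v)) (Cmod_ge_0 (g' v)) A2 B2); nra. }
    assert (X2 : (Cmod (f v * b) <= M * N * Cmod h ^ 2)%R).
    { rewrite Cmod_mult.
      pose proof (P _ _ _ _ (Cmod_ge_0 (f v)) (Cmod_ge_0 b) A1 B3); lra. }
    assert (X3 : (Cmod (h * (f' v * b)) <= M * N * Cmod h ^ 2)%R).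
    { rewrite !Cmod_mult.
      pose proof (P _ _ _ _ (Cmod_ge_0 (f' v)) (Cmod_ge_0 b) A2 B3).
      eapply Rle_trans; [apply T, Rmult_le_pos; apply Cmod_ge_0 | lra]. }
    assert (X4 : (Cmod (a * g v) <= M * N * Cmod h ^ 2)%R).
    { rewrite Cmod_mult.
      pose proof (P _ _ _ _ (Cmod_ge_0 a) (Cmod_ge_0 (g v)) A3 B1); lra. }
    assert (X5 : (Cmod (h * (a * g' v)) <= M * N * Cmod h ^ 2)%R).
    { rewrite !Cmod_mult.
      pose proof (P _ _ _ _ (Cmod_ge_0 a) (Cmod_ge_0 (g' v)) A3 B2).
      eapply Rle_trans; [apply T, Rmult_le_pos; apply Cmod_ge_0 | lra]. }
    assert (X6 : (Cmod (a * b) <= M * N * Cmod h ^ 2)%R).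
    { rewrite Cmod_mult.
      pose proof (P _ _ _ _ (Cmod_ge_0 a) (Cmod_ge_0 b) A3 B3) as Q.
      assert (Cmod h ^ 2 * Cmod h ^ 2 <= 1 * Cmod h ^ 2)%R
        by (apply Rmult_le_compat_r; [exact Hh2 | nra]).
      assert (M * N * (Cmod h ^ 2 * Cmod h ^ 2) <= M * N * (1 * Cmod h ^ 2))%R
        by (apply Rmult_le_compat_l; assumption).
      lra. }
    pose proof (Cmod_triangle (h * h * (f' v * g' v)) (f v * b)).
    pose proof (Cmod_triangle (h * h * (f' v * g' v) + f v * b)
                  (h * (f' v * b))).
    pose proof (Cmod_triangle (h * h * (f' v * g' v) + f v * b
                  + h * (f' v * b)) (a * g v)).
    pose proof (Cmod_triangle (h * h * (f' v * g' v) + f v * b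
                  + h * (f' v * b) + a * g v) (h * (a * g' v))).
    pose proof (Cmod_triangle (h * h * (f' v * g' v) + f v * b
                  + h * (f' v * b) + a * g v + h * (a * g' v)) (a * b)).
    lra.
Qed.

Lemma hol_Cexp (f : C -> C) : hol f -> hol (fun v => Cexp (f v)).
Proof.
  intros [f' Hf]; exists (fun v => f' v * Cexp (f v)); intros r.
  destruct (Hf r) as [M [HM Kf]].
  (* The increment [w] of [f] satisfies [Cmod w <= 2 * M * Cmod h <= 2 * M]. The first summand comes
     from the remainder of [Cexp] at [w], the second from the remainder of [f]. *)
  set (K := (4 * exp (2 * M) * (2 * M) ^ 2 + M)%R).
  assert (HK : (M <= K)%R).
  { unfold K; pose proof (exp_pos (2 * M)); pose proof (pow2_ge_0 (2 * M)).
    nra. }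
  assert (HeM : (1 <= exp M)%R) by (pose proof (exp_ineq1_le M); lra).
  exists (exp M * (K + 1))%R; split; [nra|]; intros v h Hv Hh.
  destruct (Kf v h Hv Hh) as [A1 [A2 A3]].
  assert (Hef : (Cmod (Cexp (f v)) <= exp M)%R).
  { rewrite Cmod_Cexp; apply exp_monotone.
    pose proof (re_le_Cmod (f v)); pose proof (Rle_abs (Re (f v))); lra. }
  pose proof (Cmod_ge_0 (Cexp (f v))) as Hef0.
  pose proof (Cmod_ge_0 (f' v)) as Hf'0.
  repeat split.
  - nra.
  - rewrite Cmod_mult.
    assert (Cmod (f' v) * Cmod (Cexp (f v)) <= K * exp M)%R
      by (apply Rmult_le_compat; lra).
    lra.
  - pose proof (hol_deriv_near f f' M v h Hh HM A2 A3) as Hw.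
    set (w := f (v + h) - f v) in *.
    replace (f (v + h)) with (f v + w) by (unfold w; ring).
    rewrite Cexp_add.
    replace (Cexp (f v) * Cexp w - Cexp (f v) - h * (f' v * Cexp (f v))) with
      (Cexp (f v) * ((Cexp w - 1 - w) + (w - h * f' v))) by ring.
    rewrite Cmod_mult.
    pose proof (Cmod_ge_0 h) as Hh0; pose proof (Cmod_ge_0 w) as Hw0.
    assert (Hw1 : (Cmod w <= 2 * M)%R) by nra.
    assert (Hw2 : (Cmod w ^ 2 <= (2 * M) ^ 2 * Cmod h ^ 2)%R).
    { rewrite <- Rpow_mult_distr; apply pow_incr; lra. }
    assert (B1 : (Cmod (Cexp w - 1 - w)
                  <= 4 * exp (2 * M) * (2 * M) ^ 2 * Cmod h ^ 2)%R).
    { eapply Rle_trans; [apply Cexp_sub2_bound|].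
      rewrite (Rmult_assoc (4 * exp (2 * M))).
      apply Rmult_le_compat; try apply pow2_ge_0; [|
        |exact Hw2].
      - pose proof (exp_pos (Cmod w)); lra.
      - pose proof (exp_monotone _ _ Hw1); lra. }
    assert (B2 : (Cmod ((Cexp w - 1 - w) + (w - h * f' v))
                  <= (K + 1) * Cmod h ^ 2)%R).
    { eapply Rle_trans; [apply Cmod_triangle|].
      unfold K; pose proof (pow2_ge_0 (Cmod h)); nra. }
    rewrite Rmult_assoc.
    apply Rmult_le_compat; try apply Cmod_ge_0; assumption.
Qed.

(* Locally uniform limits of differentiable functions, so that infinite
   products qualify without being differentiated. *)
Definition entire (f : C -> C) : Prop :=
  forall r eps : R, (0 < eps)%R -> exists g, hol g /\
    forall v, (Cmod v <= r)%R -> (Cmod (f v - g v)%C <= eps)%R.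

Lemma hol_entire (f : C -> C) : hol f -> entire f.
Proof.
  intros Hf r eps He; exists f; split; [exact Hf|]; intros v _.
  replace (f v - f v) with (RtoC 0) by ring; rewrite Cmod_0; lra.
Qed.

Lemma entire_ext (f g : C -> C) : (forall v, f v = g v) -> entire f -> entire g.
Proof.
  intros E Hf r eps He; destruct (Hf r eps He) as [k [Hk K]].
  exists k; split; [exact Hk|]; intros v Hv; rewrite <- E; auto.
Qed.

Lemma entire_plus (f g : C -> C) :
  entire f -> entire g -> entire (fun v => f v + g v).
Proof.
  intros Hf Hg r eps He.
  destruct (Hf r (eps / 2)%R ltac:(lra)) as [k [Hk K]].
  destruct (Hg r (eps / 2)%R ltac:(lra)) as [l [Hl L]].
  exists (fun v => k v + l v); split; [apply hol_plus; assumption|].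
  intros v Hv.
  replace (f v + g v - (k v + l v)) with ((f v - k v) + (g v - l v)) by ring.
  eapply Rle_trans; [apply Cmod_triangle|].
  specialize (K v Hv); specialize (L v Hv); lra.
Qed.

Lemma entire_bounded (f : C -> C) (r : R) : entire f ->
  exists M : R, (0 <= M)%R /\ forall v, (Cmod v <= r)%R -> (Cmod (f v) <= M)%R.
Proof.
  intros Hf; destruct (Hf r 1%R ltac:(lra)) as [k [[k' Hk] K]].
  destruct (Hk r) as [M [HM B]].
  exists (M + 1)%R; split; [lra|]; intros v Hv.
  destruct (B v 0 Hv) as [B1 _]; [rewrite Cmod_0; lra|].
  replace (f v) with ((f v - k v) + k v) by ring.
  eapply Rle_trans; [apply Cmod_triangle|]; specialize (K v Hv); lra.
Qed.

Lemma entire_mult (f g : C -> C) :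
  entire f -> entire g -> entire (fun v => f v * g v).
Proof.
  intros Hf Hg r eps He.
  (* In [(f - k) * g + k * (g - l)] the accuracy required of [l] depends on a bound for [k], so [k]
     is chosen first. *)
  destruct (entire_bounded g r Hg) as [N [HN BN]].
  destruct (Hf r (Rmin 1 (eps / (2 * (N + 1))))%R) as [k [Hk K]].
  { apply Rmin_pos; [lra | apply Rdiv_lt_0_compat; lra]. }
  destruct (entire_bounded k r (hol_entire _ Hk)) as [M [HM BM]].
  destruct (Hg r (eps / (2 * (M + 1)))%R) as [l [Hl L]].
  { apply Rdiv_lt_0_compat; lra. }
  exists (fun v => k v * l v); split; [apply hol_mult; assumption|].
  intros v Hv.
  replace (f v * g v - k v * l v) with
    ((f v - k v) * g v + k v * (g v - l v)) by ring.
  eapply Rle_trans; [apply Cmod_triangle|]; rewrite !Cmod_mult.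
  specialize (K v Hv); specialize (L v Hv).
  specialize (BN v Hv); specialize (BM v Hv).
  assert (K2 : (Cmod (f v - k v) <= eps / (2 * (N + 1)))%R)
    by (eapply Rle_trans; [exact K | apply Rmin_r]).
  pose proof (Rmult_le_compat _ _ _ _ (Cmod_ge_0 (f v - k v))
                (Cmod_ge_0 (g v)) K2 BN) as X1.
  pose proof (Rmult_le_compat _ _ _ _ (Cmod_ge_0 (k v))
                (Cmod_ge_0 (g v - l v)) BM L) as X2.
  assert (Y : forall m, (0 <= m)%R -> (m * (eps / (2 * (m + 1))) <= eps / 2)%R).
  { intros m Hm.
    replace (eps / 2)%R with ((m + 1) * (eps / (2 * (m + 1))))%R
      by (field; lra).
    apply Rmult_le_compat_r; [|lra].
    left; apply Rdiv_lt_0_compat; lra. }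
  pose proof (Y N HN); pose proof (Y M HM); lra.
Qed.

Lemma entire_const (c : C) : entire (fun _ => c).
Proof. apply hol_entire, hol_const. Qed.

Lemma hol_Cprod (f : nat -> C -> C) (N : nat) :
  (forall n, hol (f n)) -> hol (fun v => Cprod (fun n => f n v) N).
Proof.
  intros H; induction N; simpl; [apply hol_const | apply hol_mult; auto].
Qed.

Lemma hol_cis_affine (a b : C) : hol (fun v => cis (a * v + b)).
Proof.
  apply hol_Cexp, hol_mult; [apply hol_const|].
  apply hol_plus; [|apply hol_const].
  apply hol_mult; [apply hol_const | apply hol_id].
Qed.

Lemma hol_cis_quadratic (a b c : C) :
  hol (fun v => cis (a * (v * v) + b * v + c)).
Proof.
  apply hol_Cexp, hol_mult; [apply hol_const|].
  apply hol_plus; [apply hol_plus|apply hol_const].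
  - apply hol_mult; [apply hol_const | apply hol_mult; apply hol_id].
  - apply hol_mult; [apply hol_const | apply hol_id].
Qed.

Lemma geom_const_monotone (B B' rho : R) :
  (0 <= rho < 1)%R -> (0 <= B <= B')%R ->
  (geom_const B rho <= geom_const B' rho)%R.
Proof.
  intros Hr HB; unfold geom_const.
  assert (H : (B / (1 - rho) <= B' / (1 - rho))%R).
  { apply Rmult_le_compat_r; [left; apply Rinv_0_lt_compat|]; lra. }
  apply Rmult_le_compat; [left; apply exp_pos | apply Rdiv_le_0_compat; lra
    | apply exp_monotone, H | exact H].
Qed.

(** The tail estimate of [qprod q z] is monotone in [Cmod z], which is bounded on discs; the partial
    products are therefore locally uniform approximants. *)
Lemma entire_qprod (q a b c : C) : (Cmod q < 1)%R ->
  entire (fun v => qprod q (c * cis (a * v + b))).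
Proof.
  intros Hq r eps He.
  assert (Hz : hol (fun v => c * cis (a * v + b))).
  { apply hol_mult; [apply hol_const | apply hol_cis_affine]. }
  destruct (entire_bounded _ r (hol_entire _ Hz)) as [B [HB KB]].
  assert (Hr : (0 <= Cmod q < 1)%R) by (split; [apply Cmod_ge_0 | exact Hq]).
  set (A := geom_const B (Cmod q)).
  assert (HA : (0 <= A)%R) by (apply geom_const_pos; assumption).
  destruct (pow_lt_1_zero (Cmod q) ltac:(rewrite Rabs_pos_eq; lra)
              (eps / (A + 1))%R) as [N HN].
  { apply Rdiv_lt_0_compat; lra. }
  exists (fun v => Cprod (fun n => 1 - c * cis (a * v + b) * q ^ n) N).
  split.
  - apply (hol_Cprod (fun n v => 1 - c * cis (a * v + b) * q ^ n)).
    intros n.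
    destruct (hol_plus (fun _ => 1) (fun v => - q ^ n * (c * cis (a * v + b)))
      (hol_const _) (hol_mult _ _ (hol_const _) Hz)) as [g' Hg].
    exists g'; intros r'; destruct (Hg r') as [M [HM K]]; exists M.
    split; [exact HM|]; intros v h Hv Hh.
    destruct (K v h Hv Hh) as [A1 [A2 A3]].
    replace (1 - c * cis (a * v + b) * q ^ n) with
      (1 + - q ^ n * (c * cis (a * v + b))) by ring.
    replace (1 - c * cis (a * (v + h) + b) * q ^ n) with
      (1 + - q ^ n * (c * cis (a * (v + h) + b))) by ring.
    auto.
  - intros v Hv; rewrite Cmod_sub_comm.
    eapply Rle_trans; [apply qprod_cv, Hq|].
    specialize (HN N (Nat.le_refl N)).
    rewrite Rabs_pos_eq in HN by (apply pow_le; lra).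
    apply Rle_trans with (A * (eps / (A + 1)))%R.
    + apply Rmult_le_compat.
      * apply geom_const_pos; [exact Hr | apply Cmod_ge_0].
      * apply pow_le; lra.
      * apply geom_const_monotone; [exact Hr|].
        split; [apply Cmod_ge_0 | apply KB, Hv].
      * lra.
    + replace eps with ((A + 1) * (eps / (A + 1)))%R at 2 by (field; lra).
      apply Rmult_le_compat_r; [|lra].
      left; apply Rdiv_lt_0_compat; lra.
Qed.

(** For [f'], add the remainders of the step [h] at [v] and of the step [- h] at [v + h]: the values
    of [f] cancel and [h * (f' (v + h) - f' v)] is left. The disc is enlarged by 1 so that it
    contains [v + h]. *)
Lemma hol_lipschitz (f f' : C -> C) (r : R) : hol_deriv f f' ->
  exists M : R, (0 <= M)%R /\ forall v h, (Cmod v <= r)%R -> (Cmod h <= 1)%R ->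
    (Cmod (f (v + h) - f v)%C <= M * Cmod h)%R /\
    (Cmod (f' (v + h) - f' v)%C <= M * Cmod h)%R.
Proof.
  intros Hf; destruct (Hf (r + 1)%R) as [M [HM K]].
  exists (2 * M)%R; split; [lra|]; intros v h Hv Hh.
  destruct (K v h ltac:(lra) Hh) as [A1 [A2 A3]].
  split; [apply (hol_deriv_near f f'); assumption|].
  assert (Hvh : (Cmod (v + h) <= r + 1)%R)
    by (eapply Rle_trans; [apply Cmod_triangle | lra]).
  destruct (K (v + h) (- h) Hvh ltac:(rewrite Cmod_opp; exact Hh))
    as [_ [_ B3]].
  rewrite Cmod_opp in B3.
  replace (v + h + - h) with v in B3 by ring.
  set (X := f (v + h) - f v - h * f' v) in *.
  set (Y := f v - f (v + h) - - h * f' (v + h)) in *.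
  destruct (Req_dec (Cmod h) 0) as [H0 | H0].
  - apply Cmod_eq_0 in H0; rewrite H0, Cplus_0_r.
    replace (f' v - f' v) with (RtoC 0) by ring; rewrite Cmod_0; lra.
  - assert (Hh0 : (0 < Cmod h)%R) by (pose proof (Cmod_ge_0 h); lra).
    apply Rmult_le_reg_l with (Cmod h); [exact Hh0|].
    rewrite <- Cmod_mult.
    replace (h * (f' (v + h) - f' v)) with (X + Y) by (unfold X, Y; ring).
    eapply Rle_trans; [apply Cmod_triangle|]; nra.
Qed.

(** * Integrals along horizontal unit segments *)

Definition cont_path (g : R -> C) : Prop :=
  forall t, continuous (fun s => Re (g s)) t /\
            continuous (fun s => Im (g s)) t.

Lemma cont_path_eps (g : R -> C) :
  (forall t eps, (0 < eps)%R -> exists d, (0 < d)%R /\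
     forall s, (Rabs (s - t) < d)%R -> (Cmod (g s - g t)%C <= eps)%R) ->
  cont_path g.
Proof.
  intros H.
  assert (aux : forall p : C -> R,
    (forall z w, Rabs (p z - p w) <= Cmod (z - w))%R ->
    forall t, continuous (fun s => p (g s)) t).
  { intros p Hp t; apply continuity_pt_filterlim, continuity_pt_locally.
    intros eps; destruct (H t (eps / 2)%R) as [d [Hd K]].
    { destruct eps; simpl; lra. }
    exists (mkposreal d Hd); intros s Hs.
    eapply Rle_lt_trans; [apply Hp|].
    eapply Rle_lt_trans; [apply K, Hs|]; destruct eps; simpl; lra. }
  intros t; split; apply aux; intros.
  - rewrite <- Re_minus; apply re_le_Cmod.
  - rewrite <- Im_minus; apply Im_le_Cmod.
Qed.

Lemma cont_path_lipschitz (g : R -> C) :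
  (forall t, exists M, (0 <= M)%R /\
     forall s, (Rabs (s - t) <= 1)%R ->
       (Cmod (g s - g t)%C <= M * Rabs (s - t))%R) ->
  cont_path g.
Proof.
  intros H; apply cont_path_eps; intros t eps He.
  destruct (H t) as [M [HM K]].
  exists (Rmin 1 (eps / (M + 1)))%R; split.
  { apply Rmin_pos; [lra | apply Rdiv_lt_0_compat; lra]. }
  intros s Hs.
  pose proof (Rmin_l 1 (eps / (M + 1))); pose proof (Rmin_r 1 (eps / (M + 1))).
  eapply Rle_trans; [apply K; lra|].
  replace eps with ((M + 1) * (eps / (M + 1)))%R by (field; lra).
  apply Rmult_le_compat; try apply Rabs_pos; lra.
Qed.

Lemma hol_cont_path (f f' : C -> C) (v : C) : hol_deriv f f' ->
  cont_path (fun t => f (v + RtoC t)) /\ cont_path (fun t => f' (v + RtoC t)).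
Proof.
  intros Hf.
  assert (H : forall t, exists M, (0 <= M)%R /\
     forall s, (Rabs (s - t) <= 1)%R ->
       (Cmod (f (v + RtoC s) - f (v + RtoC t))%C <= M * Rabs (s - t))%R /\
       (Cmod (f' (v + RtoC s) - f' (v + RtoC t))%C <= M * Rabs (s - t))%R).
  { intros t.
    destruct (hol_lipschitz f f' (Cmod (v + RtoC t)) Hf) as [M [HM K]].
    exists M; split; [exact HM|]; intros s Hs.
    specialize (K (v + RtoC t) (RtoC (s - t)) (Rle_refl _)
                  ltac:(rewrite Cmod_R; exact Hs)).
    replace (v + RtoC t + RtoC (s - t)) with (v + RtoC s) in K
      by (rewrite RtoC_minus; ring).
    rewrite Cmod_R in K; exact K. }
  split; apply cont_path_lipschitz; intros t; destruct (H t) as [M [HM K]];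
    exists M; (split; [exact HM|]); intros s Hs; apply (K s Hs).
Qed.

Lemma entire_cont_path (f : C -> C) (v : C) :
  entire f -> cont_path (fun t => f (v + RtoC t)).
Proof.
  intros Hf; apply cont_path_eps; intros t eps He.
  destruct (Hf (Cmod (v + RtoC t) + 1)%R (eps / 3)%R ltac:(lra))
    as [k [[k' Hk] K]].
  destruct (hol_lipschitz k k' (Cmod (v + RtoC t)) Hk) as [M [HM L]].
  exists (Rmin 1 (eps / (3 * (M + 1))))%R; split.
  { apply Rmin_pos; [lra | apply Rdiv_lt_0_compat; lra]. }
  intros s Hs.
  pose proof (Rmin_l 1 (eps / (3 * (M + 1)))) as m1.
  pose proof (Rmin_r 1 (eps / (3 * (M + 1)))) as m2.
  assert (E : v + RtoC s = v + RtoC t + RtoC (s - t))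
    by (rewrite RtoC_minus; ring).
  destruct (L (v + RtoC t) (RtoC (s - t)) (Rle_refl _)) as [L1 _].
  { rewrite Cmod_R; lra. }
  rewrite <- E, Cmod_R in L1.
  assert (K1 := K (v + RtoC t) ltac:(lra)).
  assert (K2 : (Cmod (f (v + RtoC s) - k (v + RtoC s))%C <= eps / 3)%R).
  { apply K; rewrite E; eapply Rle_trans; [apply Cmod_triangle|].
    rewrite Cmod_R; lra. }
  assert (L2 : (M * Rabs (s - t) <= eps / 3)%R).
  { replace (eps / 3)%R with ((M + 1) * (eps / (3 * (M + 1))))%R
      by (field; lra).
    apply Rmult_le_compat; try apply Rabs_pos; lra. }
  pose proof (Cmod_sub_triangle (f (v + RtoC s)) (k (v + RtoC s))
                (f (v + RtoC t))) as T1.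
  pose proof (Cmod_sub_triangle (k (v + RtoC s)) (k (v + RtoC t))
                (f (v + RtoC t))) as T2.
  rewrite (Cmod_sub_comm (k (v + RtoC t)) (f (v + RtoC t))) in T2; lra.
Qed.

Definition CInt (g : R -> C) : C :=
  (RInt (fun t => Re (g t)) 0 1, RInt (fun t => Im (g t)) 0 1).

Lemma cont_path_ex_RInt (g : R -> C) (a b : R) : cont_path g ->
  ex_RInt (fun t => Re (g t)) a b /\ ex_RInt (fun t => Im (g t)) a b.
Proof.
  intros H; split; apply (ex_RInt_continuous (V := R_CompleteNormedModule));
    intros t _; apply (H t).
Qed.

Lemma CInt_ext (f g : R -> C) : (forall t, f t = g t) -> CInt f = CInt g.
Proof.
  intros E; unfold CInt; f_equal; apply RInt_ext; intros t _; rewrite E;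
    reflexivity.
Qed.

Lemma cont_path_plus (f g : R -> C) : cont_path f -> cont_path g ->
  cont_path (fun t => f t + g t).
Proof.
  intros Hf Hg t; destruct (Hf t), (Hg t); split.
  - apply (continuous_plus (fun s => Re (f s)) (fun s => Re (g s)));
      assumption.
  - apply (continuous_plus (fun s => Im (f s)) (fun s => Im (g s)));
      assumption.
Qed.

Lemma cont_path_mult (f g : R -> C) : cont_path f -> cont_path g ->
  cont_path (fun t => f t * g t).
Proof.
  intros Hf Hg t; destruct (Hf t), (Hg t); split.
  - apply (continuous_minus (fun s => Re (f s) * Re (g s))%R
             (fun s => Im (f s) * Im (g s))%R);
      apply (continuous_mult (K := R_AbsRing)); assumption.
  - apply (continuous_plus (fun s => Re (f s) * Im (g s))%R
             (fun s => Im (f s) * Re (g s))%R);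
      apply (continuous_mult (K := R_AbsRing)); assumption.
Qed.

Lemma cont_path_const (c : C) : cont_path (fun _ => c).
Proof. intros t; split; apply continuous_const. Qed.

Lemma CInt_plus (f g : R -> C) : cont_path f -> cont_path g ->
  CInt (fun t => f t + g t) = CInt f + CInt g.
Proof.
  intros Hf Hg.
  destruct (cont_path_ex_RInt f 0 1 Hf), (cont_path_ex_RInt g 0 1 Hg).
  apply C_eq.
  - apply (RInt_plus (fun t => Re (f t)) (fun t => Re (g t))); assumption.
  - apply (RInt_plus (fun t => Im (f t)) (fun t => Im (g t))); assumption.
Qed.

Lemma CInt_scal (c : C) (f : R -> C) : cont_path f ->
  CInt (fun t => c * f t) = c * CInt f.
Proof.
  intros Hf; destruct (cont_path_ex_RInt f 0 1 Hf) as [HR HI].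
  assert (S : forall (k : R) h, ex_RInt h 0 1 ->
    RInt (fun t => k * h t)%R 0 1 = (k * RInt h 0 1)%R)
    by (intros; apply (RInt_scal h); assumption).
  assert (E : forall (k : R) h, ex_RInt h 0 1 ->
    ex_RInt (fun t => k * h t)%R 0 1)
    by (intros; apply (ex_RInt_scal h); assumption).
  apply C_eq.
  - change (RInt (fun t => Re c * Re (f t) - Im c * Im (f t))%R 0 1
            = (Re c * RInt (fun t => Re (f t)) 0 1
               - Im c * RInt (fun t => Im (f t)) 0 1)%R).
    rewrite <- !S by assumption.
    apply (RInt_minus (fun t => Re c * Re (f t))%R
             (fun t => Im c * Im (f t))%R); apply E; assumption.
  - change (RInt (fun t => Re c * Im (f t) + Im c * Re (f t))%R 0 1
            = (Re c * RInt (fun t => Im (f t)) 0 1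
               + Im c * RInt (fun t => Re (f t)) 0 1)%R).
    rewrite <- !S by assumption.
    apply (RInt_plus (fun t => Re c * Im (f t))%R
             (fun t => Im c * Re (f t))%R); apply E; assumption.
Qed.

Lemma CInt_bound (f : R -> C) (B : R) : cont_path f ->
  (forall t, (0 <= t <= 1)%R -> (Cmod (f t) <= B)%R) ->
  (Cmod (CInt f) <= 2 * B)%R.
Proof.
  intros Hf HB; destruct (cont_path_ex_RInt f 0 1 Hf) as [HR HI].
  assert (aux : forall h : R -> R, ex_RInt h 0 1 ->
    (forall t, (0 <= t <= 1)%R -> (Rabs (h t) <= B)%R) ->
    (Rabs (RInt h 0 1) <= B)%R).
  { intros h Hh K.
    replace B with ((1 - 0) * B)%R by ring.
    apply (norm_RInt_le_const h 0 1 _ B); [lra | exact K|].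
    apply (RInt_correct h), Hh. }
  eapply Rle_trans; [apply Cmod_le_Re_Im|]; simpl.
  assert (X1 := aux _ HR); assert (X2 := aux _ HI).
  specialize (X1 ltac:(intros t Ht; eapply Rle_trans;
    [apply re_le_Cmod | apply HB, Ht])).
  specialize (X2 ltac:(intros t Ht; eapply Rle_trans;
    [apply Im_le_Cmod | apply HB, Ht])).
  lra.
Qed.

Lemma CInt_derive (f f' : C -> C) (v : C) : hol_deriv f f' ->
  CInt (fun t => f' (v + RtoC t)) = f (v + 1) - f v.
Proof.
  intros Hf; destruct (hol_cont_path f f' v Hf) as [_ Hc].
  (* [p] stands for [Re] and [Im]: the fundamental theorem of calculus is applied to each real
     coordinate, and the quadratic remainder supplies the derivative. *)
  assert (D : forall p : C -> R,
    (forall z, Rabs (p z) <= Cmod z)%R ->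
    (forall z w, p (z - w)%C = p z - p w)%R ->
    (forall (x : R) z, p (RtoC x * z)%C = x * p z)%R ->
    forall t : R, is_derive (fun s : R => p (f (v + RtoC s))) t
                            (p (f' (v + RtoC t)))).
  { intros p P1 P2 P3 t; apply is_derive_Reals; intros eps He.
    destruct (Hf (Cmod (v + RtoC t))) as [M [HM K]].
    assert (Hd : (0 < Rmin 1 (eps / (M + 1)))%R)
      by (apply Rmin_pos; [lra | apply Rdiv_lt_0_compat; lra]).
    exists (mkposreal _ Hd); simpl; intros h Hh0 Hh.
    pose proof (Rmin_l 1 (eps / (M + 1))).
    pose proof (Rmin_r 1 (eps / (M + 1))).
    destruct (K (v + RtoC t) (RtoC h) (Rle_refl _)) as [_ [_ K3]].
    { rewrite Cmod_R; lra. }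
    rewrite Cmod_R in K3.
    replace (v + RtoC t + RtoC h) with (v + RtoC (t + h)) in K3
      by (rewrite RtoC_plus; ring).
    set (W := f (v + RtoC (t + h)) - f (v + RtoC t)
              - RtoC h * f' (v + RtoC t)) in *.
    replace ((p (f (v + RtoC (t + h))%C) - p (f (v + RtoC t)%C)) / h
             - p (f' (v + RtoC t)%C))%R with (p W / h)%R
      by (unfold W; rewrite !P2, P3; field; exact Hh0).
    pose proof (Rabs_pos_lt h Hh0) as Hp.
    rewrite Rabs_div by exact Hh0.
    apply Rmult_lt_reg_r with (Rabs h); [exact Hp|].
    replace (Rabs (p W) / Rabs h * Rabs h)%R with (Rabs (p W)) by (field; lra).
    eapply Rle_lt_trans; [apply P1|].
    eapply Rle_lt_trans; [exact K3|].
    simpl; rewrite Rmult_1_r, <- Rmult_assoc.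
    apply Rmult_lt_compat_r; [exact Hp|].
    apply Rle_lt_trans with (M * (eps / (M + 1)))%R.
    - apply Rmult_le_compat_l; lra.
    - replace eps with ((M + 1) * (eps / (M + 1)))%R at 2 by (field; lra).
      apply Rmult_lt_compat_r; [apply Rdiv_lt_0_compat; lra | lra]. }
  assert (F : forall p : C -> R,
    (forall t : R, is_derive (fun s : R => p (f (v + RtoC s))) t
                             (p (f' (v + RtoC t)))) ->
    (forall t, continuous (fun s : R => p (f' (v + RtoC s))) t) ->
    RInt (fun t : R => p (f' (v + RtoC t))) 0 1
    = (p (f (v + 1)%C) - p (f v))%R).
  { intros p Hp Hcp; apply is_RInt_unique.
    replace (p (f (v + 1)%C) - p (f v))%R with
      (minus (p (f (v + RtoC 1)%C)) (p (f (v + RtoC 0)%C)))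
      by (rewrite Cplus_0_r; reflexivity).
    apply (is_RInt_derive (fun s : R => p (f (v + RtoC s)))); auto. }
  apply C_eq; [rewrite Re_minus | rewrite Im_minus].
  - apply (F Re); [|intros t; apply Hc].
    apply (D Re); [apply re_le_Cmod | apply Re_minus|].
    intros x z; destruct z; simpl; ring.
  - apply (F Im); [|intros t; apply Hc].
    apply (D Im); [apply Im_le_Cmod | apply Im_minus|].
    intros x z; destruct z; simpl; ring.
Qed.

(** * Fourier coefficients *)

(* Subdividing [h] into [n] equal steps makes the quadratic error O(1/n). *)
Lemma increment_bound (phi : C -> C) (r A B : R) (v h : C) :
  (0 <= B)%R ->
  (forall w k, (Cmod w <= r)%R -> (Cmod k <= 1)%R ->
     (Cmod (phi (w + k)%C - phi w)%C <= A * Cmod k + B * Cmod k ^ 2)%R) ->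
  (Cmod v + Cmod h <= r)%R ->
  (Cmod (phi (v + h)%C - phi v)%C <= A * Cmod h)%R.
Proof.
  intros HB H Hr; apply Rnot_lt_le; intros Hlt.
  set (d := (Cmod (phi (v + h)%C - phi v)%C - A * Cmod h)%R).
  assert (Hd : (0 < d)%R) by (unfold d; lra).
  pose proof (Cmod_ge_0 h) as Hh.
  assert (HS : forall n : nat, (0 < INR n)%R -> (Cmod h <= INR n)%R ->
    (d * INR n <= B * Cmod h ^ 2)%R).
  { intros n Hn Hhn.
    set (k := h * RtoC (/ INR n)).
    assert (Hk : Cmod k = (Cmod h / INR n)%R).
    { unfold k; rewrite Cmod_mult, Cmod_R, Rabs_pos_eq; [reflexivity|].
      left; apply Rinv_0_lt_compat, Hn. }
    assert (Hk1 : (Cmod k <= 1)%R).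
    { rewrite Hk; apply Rmult_le_reg_r with (INR n); [exact Hn|].
      unfold Rdiv; rewrite Rmult_assoc, Rinv_l by lra; lra. }
    assert (Hi : forall i : nat, (i <= n)%nat ->
      (Cmod (phi (v + RtoC (INR i) * k)%C - phi v)%C
       <= INR i * (A * Cmod k + B * Cmod k ^ 2))%R).
    { induction i as [|i IH]; intros Hin.
      - simpl INR; rewrite Cmult_0_l, Cplus_0_r.
        replace (phi v - phi v) with (RtoC 0) by ring; rewrite Cmod_0; lra.
      - rewrite S_INR, RtoC_plus.
        replace (v + (RtoC (INR i) + RtoC 1) * k) with
          (v + RtoC (INR i) * k + k) by ring.
        specialize (IH ltac:(lia)).
        assert (Hw : (Cmod (v + RtoC (INR i) * k)%C <= r)%R).
        { eapply Rle_trans; [apply Cmod_triangle|].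
          rewrite Cmod_mult, Cmod_R, (Rabs_pos_eq (INR i)) by apply pos_INR.
          assert (INR i * Cmod k <= INR n * Cmod k)%R.
          { apply Rmult_le_compat_r; [apply Cmod_ge_0|].
            apply le_INR; lia. }
          assert (INR n * Cmod k = Cmod h)%R by (rewrite Hk; field; lra).
          lra. }
        specialize (H _ k Hw Hk1).
        pose proof (Cmod_sub_triangle (phi (v + RtoC (INR i) * k + k))
          (phi (v + RtoC (INR i) * k)) (phi v)).
        lra. }
    specialize (Hi n (Nat.le_refl n)).
    replace (RtoC (INR n) * k) with h in Hi.
    2:{ unfold k; rewrite RtoC_inv by lra; field.
        apply RtoC_neq_0; lra. }
    assert (E : (INR n * (A * Cmod k + B * Cmod k ^ 2)
                 = A * Cmod h + B * Cmod h ^ 2 / INR n)%R)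
      by (rewrite Hk; field; lra).
    rewrite E in Hi.
    assert (Hd' : (d <= B * Cmod h ^ 2 / INR n)%R) by (unfold d; lra).
    apply Rmult_le_compat_r with (r := INR n) in Hd'; [|lra].
    replace (B * Cmod h ^ 2 / INR n * INR n)%R with (B * Cmod h ^ 2)%R in Hd'
      by (field; lra).
    exact Hd'. }
  (* Any number of steps above [B * Cmod h ^ 2 / d] contradicts [HS]; being above [Cmod h] keeps
     each step of length at most 1. *)
  destruct (nfloor_ex (Rmax (Cmod h) (B * Cmod h ^ 2 / d))) as [n [_ Hn]].
  { eapply Rle_trans; [exact Hh | apply Rmax_l]. }
  pose proof (Rmax_l (Cmod h) (B * Cmod h ^ 2 / d)).
  pose proof (Rmax_r (Cmod h) (B * Cmod h ^ 2 / d)).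
  rewrite <- S_INR in Hn.
  specialize (HS (S n) ltac:(lra) ltac:(lra)).
  assert (H3 : (B * Cmod h ^ 2 / d < INR (S n))%R) by lra.
  apply Rmult_lt_compat_r with (r := d) in H3; [|exact Hd].
  replace (B * Cmod h ^ 2 / d * d)%R with (B * Cmod h ^ 2)%R in H3
    by (field; lra).
  lra.
Qed.

Ltac solve_cont_path :=
  match goal with
  | H : cont_path ?f |- cont_path ?f => exact H
  | |- cont_path (fun t => _ + _) => apply cont_path_plus; solve_cont_path
  | |- cont_path (fun t => _ * _) => apply cont_path_mult; solve_cont_path
  | |- cont_path (fun t => ?c) => apply cont_path_const
  | |- cont_path _ => solve [auto]
  end.

(** The integral over the segment from [v] to [v + 1] has derivative [f (v + 1) - f v] in [v], so it
    hardly moves when [f] is nearly periodic. *)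
Lemma CInt_hol_increment (f f' : C -> C) (r : R) : hol_deriv f f' ->
  exists B : R, (0 <= B)%R /\ forall v h, (Cmod v <= r)%R -> (Cmod h <= 1)%R ->
    (Cmod (CInt (fun t => f (v + h + RtoC t)) - CInt (fun t => f (v + RtoC t))
           - h * (f (v + 1) - f v))%C <= B * Cmod h ^ 2)%R.
Proof.
  intros Hf; destruct (Hf (r + 1)%R) as [M [HM K]].
  exists (2 * M)%R; split; [lra|]; intros v h Hv Hh.
  rewrite <- (CInt_derive f f' v Hf).
  destruct (hol_cont_path f f' v Hf) as [C1 C2].
  destruct (hol_cont_path f f' (v + h) Hf) as [C3 _].
  pose proof (cont_path_mult _ _ (cont_path_const (- (1))) C1) as C4.
  pose proof (cont_path_mult _ _ (cont_path_const (- h)) C2) as C5.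
  replace (CInt (fun t => f (v + h + RtoC t)) - CInt (fun t => f (v + RtoC t))
           - h * CInt (fun t => f' (v + RtoC t))) with
    (CInt (fun t => f (v + h + RtoC t) + - (1) * f (v + RtoC t)
                    + - h * f' (v + RtoC t))).
  2:{ rewrite CInt_plus by solve_cont_path.
      rewrite CInt_plus, !CInt_scal by solve_cont_path; ring. }
  rewrite (Rmult_assoc 2); apply CInt_bound.
  - solve_cont_path.
  - intros t Ht.
    assert (Hvt : (Cmod (v + RtoC t)%C <= r + 1)%R).
    { eapply Rle_trans; [apply Cmod_triangle|].
      rewrite Cmod_R, Rabs_pos_eq; lra. }
    destruct (K (v + RtoC t) h Hvt Hh) as [_ [_ K3]].
    replace (v + h + RtoC t) with (v + RtoC t + h) by ring.
    eapply Rle_trans; [|exact K3]; right; f_equal; ring.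
Qed.

Lemma CInt_minus_bound (f g : R -> C) (B : R) :
  cont_path f -> cont_path g ->
  (forall t, (0 <= t <= 1)%R -> (Cmod (f t - g t)%C <= B)%R) ->
  (Cmod (CInt f - CInt g)%C <= 2 * B)%R.
Proof.
  intros Hf Hg H.
  replace (CInt f - CInt g) with (CInt (fun t => f t + - (1) * g t)).
  - apply CInt_bound.
    + apply cont_path_plus; [assumption|].
      apply cont_path_mult; [apply cont_path_const | assumption].
    + intros t Ht; replace (f t + - (1) * g t) with (f t - g t) by ring; auto.
  - rewrite CInt_plus, CInt_scal; auto; [ring|].
    apply cont_path_mult; [apply cont_path_const | assumption].
Qed.

(** This takes the place of Cauchy's theorem on a parallelogram. Since [f] is only a limit of
    differentiable functions, the argument runs through an approximant [g], which is periodic up to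
    [2 * e]; its segment integral thus moves by at most [2 * e * Cmod h]. *)
Lemma CInt_period_const (f : C -> C) : entire f ->
  (forall v, f (v + 1) = f v) ->
  forall v h, CInt (fun t => f (v + h + RtoC t))
              = CInt (fun t => f (v + RtoC t)).
Proof.
  intros Hf Hp v h; apply Cmod_small_eq; intros eps He.
  set (r := (Cmod v + Cmod h)%R).
  pose proof (Cmod_ge_0 v) as Hv; pose proof (Cmod_ge_0 h) as Hh.
  (* The total error is [2 * e * Cmod h] for moving the segment plus [2 * e] at each end for
     replacing [f] by [g]. *)
  set (e := (eps / (2 * Cmod h + 4))%R).
  assert (He' : (0 < e)%R) by (apply Rdiv_lt_0_compat; lra).
  destruct (Hf (r + 1)%R e He') as [g [[g' Hg] G]].
  destruct (CInt_hol_increment g g' r Hg) as [B [HB K]].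
  assert (I1 : (Cmod (CInt (fun t => g (v + h + RtoC t))
                      - CInt (fun t => g (v + RtoC t)))%C <= 2 * e * Cmod h)%R).
  { apply (increment_bound (fun w => CInt (fun t => g (w + RtoC t))) r _ B);
      [exact HB | | apply Rle_refl].
    intros w k Hw Hk; specialize (K w k Hw Hk).
    set (X := CInt (fun t => g (w + k + RtoC t))
              - CInt (fun t => g (w + RtoC t))) in *.
    replace X with ((X - k * (g (w + 1) - g w)) + k * (g (w + 1) - g w))
      by ring.
    eapply Rle_trans; [apply Cmod_triangle|]; rewrite Cmod_mult.
    assert (Hgg : (Cmod (g (w + 1)%C - g w)%C <= 2 * e)%R).
    { pose proof (G w ltac:(lra)) as G1.
      assert (Hw1 : (Cmod (w + 1)%C <= r + 1)%R).
      { eapply Rle_trans; [apply Cmod_triangle|]; rewrite Cmod_1; lra. }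
      pose proof (G _ Hw1) as G2; rewrite Hp in G2.
      pose proof (Cmod_sub_triangle (g (w + 1)) (f w) (g w)).
      rewrite (Cmod_sub_comm (g (w + 1)) (f w)) in H; lra. }
    pose proof (Cmod_ge_0 k).
    assert (Cmod k * Cmod (g (w + 1)%C - g w)%C <= Cmod k * (2 * e))%R
      by (apply Rmult_le_compat_l; assumption).
    lra. }
  assert (I2 : forall w, (Cmod w <= r)%R ->
    (Cmod (CInt (fun t => f (w + RtoC t)) - CInt (fun t => g (w + RtoC t)))%C
     <= 2 * e)%R).
  { intros w Hw; apply CInt_minus_bound.
    - apply entire_cont_path, Hf.
    - apply (hol_cont_path g g' w Hg).
    - intros t Ht; apply G.
      eapply Rle_trans; [apply Cmod_triangle|].
      rewrite Cmod_R, Rabs_pos_eq; lra. }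
  pose proof (I2 v ltac:(unfold r; lra)) as J1.
  pose proof (I2 (v + h) ltac:(unfold r; apply Cmod_triangle)) as J2.
  set (F1 := CInt (fun t => f (v + RtoC t))) in *.
  set (G1 := CInt (fun t => g (v + RtoC t))) in *.
  set (F2 := CInt (fun t => f (v + h + RtoC t))) in *.
  set (G2 := CInt (fun t => g (v + h + RtoC t))) in *.
  pose proof (Cmod_sub_triangle F2 G2 F1).
  pose proof (Cmod_sub_triangle G2 G1 F1).
  rewrite (Cmod_sub_comm G1 F1) in *.
  assert (E : (2 * e * Cmod h + 4 * e = eps)%R) by (unfold e; field; lra).
  lra.
Qed.

Definition fourier (f : C -> C) (k : Z) (v : C) : C :=
  CInt (fun t => f (v + RtoC t) * cis (- RtoC (IZR k) * (v + RtoC t))).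

Lemma cis_IZR (k : Z) : cis (RtoC (IZR k)) = 1.
Proof.
  induction k as [|k IH|k IH] using Z.peano_ind.
  - apply cis_0.
  - unfold Z.succ; rewrite plus_IZR, RtoC_plus, cis_add, IH, cis_1; ring.
  - replace (Z.pred k) with (k + - (1))%Z by lia.
    rewrite plus_IZR, opp_IZR, RtoC_plus, RtoC_opp, cis_add, cis_opp, IH, cis_1.
    field.
Qed.

Lemma entire_mult_cis (f : C -> C) (a : C) : entire f ->
  entire (fun v => f v * cis (a * v)).
Proof.
  intros Hf; apply entire_mult; [exact Hf|].
  apply entire_ext with (fun v => cis (a * v + 0)).
  - intros v; f_equal; ring.
  - apply hol_entire, hol_cis_affine.
Qed.

Lemma fourier_const (f : C -> C) (k : Z) (v : C) : entire f ->
  (forall w, f (w + 1) = f w) -> fourier f k v = fourier f k 0.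
Proof.
  intros Hf Hp; unfold fourier.
  rewrite <- (CInt_period_const
    (fun w => f w * cis (- RtoC (IZR k) * w)) (entire_mult_cis f _ Hf)
    ltac:(intros w; cbv beta; rewrite Hp;
      replace (- RtoC (IZR k) * (w + 1)) with
        (- RtoC (IZR k) * w + RtoC (IZR (- k)))
        by (rewrite opp_IZR, RtoC_opp; ring);
      rewrite cis_add, cis_IZR; ring) 0 v).
  apply CInt_ext; intros t; rewrite Cplus_0_l; reflexivity.
Qed.

(* Its powers concentrate at 1/2, as in Fejer's theorem. *)
Definition bump (t : R) : R := ((1 - cos (2 * PI * t)) / 2)%R.

(** As a trigonometric polynomial of degree one, [bump] only mixes neighbouring Fourier modes; if
    all coefficients of a function vanish, so do those of its product with [bump], and inductively
    with every power. *)
Lemma bump_cis (t : R) :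
  RtoC (bump t) = / 2 - / 4 * cis (RtoC t) - / 4 * cis (- RtoC t).
Proof.
  assert (H : forall x : R, cis (RtoC x) = (cos (2 * PI * x), sin (2 * PI * x))).
  { intros x; unfold cis, Cexp; simpl.
    replace (((2 * PI - 0 * 0) * 0 - (2 * 0 + 0 * PI) * 1) * x
       - ((2 * PI - 0 * 0) * 1 + (2 * 0 + 0 * PI) * 0) * 0)%R with 0%R by ring.
    replace (((2 * PI - 0 * 0) * 0 - (2 * 0 + 0 * PI) * 1) * 0
       + ((2 * PI - 0 * 0) * 1 + (2 * 0 + 0 * PI) * 0) * x)%R
      with (2 * PI * x)%R by ring.
    rewrite exp_0, !Rmult_1_l; reflexivity. }
  rewrite <- RtoC_opp, !H.
  replace (2 * PI * - t)%R with (- (2 * PI * t))%R by ring.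
  rewrite cos_neg, sin_neg, <- !RtoC_inv by lra.
  unfold bump; apply C_eq; simpl; field.
Qed.

Lemma bump_sym (t : R) : bump (1 - t) = bump t.
Proof.
  unfold bump; do 2 f_equal.
  replace (2 * PI * (1 - t))%R with (- (2 * PI * t) + 2 * PI)%R by ring.
  rewrite cos_plus, cos_2PI, sin_2PI, cos_neg; ring.
Qed.

Lemma bump_ge_0 (t : R) : (0 <= bump t)%R.
Proof. unfold bump; pose proof (COS_bound (2 * PI * t)); lra. Qed.

Lemma bump_lt (s t : R) :
  (0 <= s -> s < t -> t <= 1 / 2 -> bump s < bump t)%R.
Proof.
  intros Hs Hst Ht; unfold bump; pose proof PI_RGT_0.
  assert (cos (2 * PI * t) < cos (2 * PI * s))%R
    by (apply cos_decreasing_1; nra).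
  lra.
Qed.

Lemma bump_le (s t : R) :
  (0 <= s -> s <= t -> t <= 1 / 2 -> bump s <= bump t)%R.
Proof.
  intros Hs [H | ->] Ht; [left; apply bump_lt; assumption | apply Rle_refl].
Qed.

Lemma continuous_bump_pow (N : nat) (t : R) :
  continuous (fun s => bump s ^ N)%R t.
Proof.
  apply (ex_derive_continuous (V := R_NormedModule)).
  unfold bump; auto_derive; exact I.
Qed.

Lemma RInt_ge_const (h : R -> R) (a b m : R) :
  (forall t, continuous h t) -> (a <= b)%R ->
  (forall t, (a <= t <= b)%R -> (m <= h t)%R) ->
  (m * (b - a) <= RInt h a b)%R.
Proof.
  intros Hc Hab H.
  replace (m * (b - a))%R with (RInt (fun _ => m) a b)
    by (rewrite RInt_const; unfold scal; simpl; unfold mult; simpl; ring).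
  apply RInt_le; [exact Hab | apply ex_RInt_const | |].
  - apply (ex_RInt_continuous (V := R_CompleteNormedModule)); auto.
  - intros t Ht; apply H; lra.
Qed.

Lemma bump_concentration (rho : R -> R) (M : R) :
  (forall t, continuous rho t) ->
  (forall t, (0 <= t <= 1)%R -> (Rabs (rho t) <= M)%R) ->
  (0 < rho (1 / 2))%R ->
  exists N : nat, (0 < RInt (fun t => rho t * bump t ^ N) 0 1)%R.
Proof.
  intros Hc HM Hpos.
  set (c := (rho (1 / 2) / 2)%R).
  assert (HM0 : (0 <= M)%R)
    by (eapply Rle_trans; [apply Rabs_pos | apply (HM 0%R); lra]).
  assert (Hloc : exists d, (0 < d <= 1 / 4)%R /\
    forall t, (Rabs (t - 1 / 2) <= d)%R -> (c <= rho t)%R).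
  { pose proof (Hc (1 / 2)%R) as H0.
    apply continuity_pt_filterlim in H0.
    rewrite continuity_pt_locally in H0.
    destruct (H0 (mkposreal c ltac:(unfold c; lra))) as [e He]; simpl in He.
    exists (Rmin (1 / 4) (e / 2))%R; destruct e as [e Hep]; simpl in *.
    split; [split; [apply Rmin_pos; lra | apply Rmin_l]|].
    intros t Ht; pose proof (Rmin_r (1 / 4) (e / 2)).
    assert (Hb : (Rabs (rho t - rho (1 / 2)) < c)%R).
    { apply He; unfold ball; simpl; unfold AbsRing_ball, abs, minus, plus, opp;
        simpl; unfold Rminus in Ht; lra. }
    apply Rabs_def2 in Hb; unfold c in *; lra. }
  destruct Hloc as [d [Hd Hrho]].
  (* [s1] bounds [bump] from above outside the window of radius [d], and [s2] bounds it from below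
     inside the window of radius [d / 2]. As [s1 < s2], the inner gain [c * d * s2 ^ N] eventually
     beats the outer loss of at most [M * s1 ^ N]. *)
  set (s1 := bump (1 / 2 - d)); set (s2 := bump (1 / 2 - d / 2)).
  assert (Hs1 : (0 <= s1)%R) by apply bump_ge_0.
  assert (Hs12 : (s1 < s2)%R) by (apply bump_lt; lra).
  assert (Hratio : (0 <= s1 / s2 < 1)%R).
  { split; [apply Rdiv_le_0_compat; lra|].
    apply Rmult_lt_reg_r with s2; [lra|].
    unfold Rdiv; rewrite Rmult_assoc, Rinv_l by lra; lra. }
  assert (Hcp : (0 < c)%R) by (unfold c; lra).
  destruct (pow_lt_1_zero (s1 / s2) ltac:(rewrite Rabs_pos_eq; lra)
             (c * d / (M + 1))%R) as [N HN].
  { apply Rdiv_lt_0_compat; nra. }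
  specialize (HN N (Nat.le_refl N)).
  rewrite Rabs_pos_eq in HN by (apply pow_le; lra).
  exists N.
  set (h := fun t => (rho t * bump t ^ N)%R).
  assert (Hh : forall t, continuous h t).
  { intros t; apply (continuous_mult (K := R_AbsRing));
      [apply Hc | apply continuous_bump_pow]. }
  assert (Hex : forall a b, ex_RInt h a b).
  { intros; apply (ex_RInt_continuous (V := R_CompleteNormedModule)); auto. }
  assert (Hs1N : (0 <= s1 ^ N)%R) by (apply pow_le; lra).
  assert (Hs2N : (0 < s2 ^ N)%R) by (apply pow_lt; lra).
  assert (Hout : forall t, (0 <= t <= 1)%R -> (bump t <= s1)%R ->
    (- (M * s1 ^ N) <= h t)%R).
  { intros t Ht Hb; unfold h.
    assert (Hb0 := bump_ge_0 t).
    assert (Hp : (bump t ^ N <= s1 ^ N)%R) by (apply pow_incr; lra).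
    assert (Hp0 : (0 <= bump t ^ N)%R) by (apply pow_le; lra).
    pose proof (HM t Ht) as HMt; apply Rabs_le_between in HMt.
    assert (M * bump t ^ N <= M * s1 ^ N)%R
      by (apply Rmult_le_compat_l; assumption).
    assert (- M * bump t ^ N <= rho t * bump t ^ N)%R
      by (apply Rmult_le_compat_r; lra).
    lra. }
  assert (Hin : forall t m, (Rabs (t - 1 / 2) <= d)%R -> (0 <= m <= bump t)%R ->
    (c * m ^ N <= h t)%R).
  { intros t m Ht Hm; unfold h.
    apply Rmult_le_compat; [lra | apply pow_le; lra | apply Hrho, Ht|].
    apply pow_incr; exact Hm. }
  assert (I1 : (- (M * s1 ^ N) * (1 / 2 - d - 0) <= RInt h 0 (1 / 2 - d))%R).
  { apply RInt_ge_const; [exact Hh | lra|].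
    intros t Ht; apply Hout; [lra|]; apply bump_le; lra. }
  assert (I2 : (0 * (1 / 2 - d / 2 - (1 / 2 - d))
                <= RInt h (1 / 2 - d) (1 / 2 - d / 2))%R).
  { apply RInt_ge_const; [exact Hh | lra|].
    intros t Ht; unfold h; apply Rmult_le_pos; [|apply pow_le, bump_ge_0].
    assert (c <= rho t)%R by (apply Hrho; rewrite Rabs_left1; lra); lra. }
  assert (I3 : (c * s2 ^ N * (1 / 2 + d / 2 - (1 / 2 - d / 2))
                <= RInt h (1 / 2 - d / 2) (1 / 2 + d / 2))%R).
  { apply RInt_ge_const; [exact Hh | lra|].
    intros t Ht; apply Hin; [apply Rabs_le; lra|].
    split; [lra|]; unfold s2.
    destruct (Rle_or_lt t (1 / 2)); [apply bump_le; lra|].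
    rewrite <- (bump_sym t); apply bump_le; lra. }
  assert (I4 : (0 * (1 / 2 + d - (1 / 2 + d / 2))
                <= RInt h (1 / 2 + d / 2) (1 / 2 + d))%R).
  { apply RInt_ge_const; [exact Hh | lra|].
    intros t Ht; unfold h; apply Rmult_le_pos; [|apply pow_le, bump_ge_0].
    assert (c <= rho t)%R by (apply Hrho; rewrite Rabs_pos_eq; lra); lra. }
  assert (I5 : (- (M * s1 ^ N) * (1 - (1 / 2 + d)) <= RInt h (1 / 2 + d) 1)%R).
  { apply RInt_ge_const; [exact Hh | lra|].
    intros t Ht; apply Hout; [lra|].
    rewrite <- bump_sym; apply bump_le; lra. }
  assert (Ch : forall a b e, (RInt h a b + RInt h b e = RInt h a e)%R)
    by (intros; apply (RInt_Chasles h); apply Hex).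
  change (0 < RInt h 0 1)%R.
  rewrite <- (Ch 0%R (1 / 2 - d)%R 1%R), <- (Ch (1 / 2 - d)%R (1 / 2 - d / 2)%R),
    <- (Ch (1 / 2 - d / 2)%R (1 / 2 + d / 2)%R),
    <- (Ch (1 / 2 + d / 2)%R (1 / 2 + d)%R).
  assert (Hkey : (M * s1 ^ N < c * d * s2 ^ N)%R).
  { assert (E : (s1 ^ N = (s1 / s2) ^ N * s2 ^ N)%R).
    { rewrite <- Rpow_mult_distr; f_equal; field; lra. }
    rewrite E, <- Rmult_assoc.
    apply Rmult_lt_compat_r; [exact Hs2N|].
    assert (E2 : (c * d = (M + 1) * (c * d / (M + 1)))%R) by (field; lra).
    assert (0 <= (s1 / s2) ^ N)%R by (apply pow_le; lra).
    assert (M * (s1 / s2) ^ N <= (M + 1) * (s1 / s2) ^ N)%R by nra.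
    assert ((M + 1) * (s1 / s2) ^ N < (M + 1) * (c * d / (M + 1)))%R
      by (apply Rmult_lt_compat_l; lra).
    lra. }
  assert (0 <= M * s1 ^ N)%R by (apply Rmult_le_pos; assumption).
  nra.
Qed.

Lemma bump_moments_zero (rho : R -> R) (M : R) :
  (forall t, continuous rho t) ->
  (forall t, (0 <= t <= 1)%R -> (Rabs (rho t) <= M)%R) ->
  (forall N, RInt (fun t => rho t * bump t ^ N)%R 0 1 = 0%R) ->
  rho (1 / 2)%R = 0%R.
Proof.
  intros Hc HM H0.
  destruct (Rtotal_order (rho (1 / 2)%R) 0) as [Hlt | [E | Hgt]]; [|exact E|].
  - destruct (bump_concentration (fun t => - rho t)%R M) as [N HN].
    + intros t; apply (continuous_opp rho), Hc.
    + intros t Ht; rewrite Rabs_Ropp; auto.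
    + lra.
    + rewrite (RInt_ext _ (fun t => -1 * (rho t * bump t ^ N))%R) in HN
        by (intros; simpl; ring).
      pose proof (RInt_scal (fun t => rho t * bump t ^ N)%R 0 1 (-1)%R) as HS.
      unfold scal in HS; simpl in HS; unfold mult in HS; simpl in HS.
      rewrite HS, H0 in HN; [lra|].
      apply (ex_RInt_continuous (V := R_CompleteNormedModule)); intros t _.
      apply (continuous_mult (K := R_AbsRing));
        [apply Hc | apply continuous_bump_pow].
  - destruct (bump_concentration rho M Hc HM Hgt) as [N HN].
    rewrite H0 in HN; lra.
Qed.

Lemma fourier_zero (f : C -> C) : entire f ->
  (forall k v, fourier f k v = 0) -> forall v, f v = 0.
Proof.
  intros Hf H0 v.
  (* The segment starts at [v - 1 / 2], so that [v] sits at parameter [1 / 2], where [bump] is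
     maximal. *)
  set (w := v - / 2).
  set (g := fun t : R => f (w + RtoC t)).
  assert (Hg : cont_path g) by apply entire_cont_path, Hf.
  assert (Hcis : forall k : Z,
    cont_path (fun t => cis (RtoC (IZR k) * RtoC t))).
  { intros k.
    intros t; destruct (entire_cont_path
      (fun s => cis (RtoC (IZR k) * s + 0)) 0
      (hol_entire _ (hol_cis_affine _ _)) t) as [A1 A2].
    split; [eapply continuous_ext; [|exact A1]
           |eapply continuous_ext; [|exact A2]];
      intros s; cbv beta; do 2 f_equal; ring. }
  assert (Hbump : forall N, cont_path (fun t => RtoC (bump t ^ N))).
  { intros N t; split; [apply continuous_bump_pow | apply continuous_const]. }
  assert (Z0 : forall k : Z,
    CInt (fun t => g t * cis (RtoC (IZR k) * RtoC t)) = 0).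
  { intros k.
    replace (CInt (fun t => g t * cis (RtoC (IZR k) * RtoC t))) with
      (cis (- RtoC (IZR k) * w) * fourier f (- k) w).
    - rewrite H0; ring.
    - unfold fourier; rewrite <- CInt_scal.
      + apply CInt_ext; intros t; unfold g.
        rewrite opp_IZR, RtoC_opp.
        replace (- - RtoC (IZR k) * (w + RtoC t)) with
          (- (- RtoC (IZR k) * w) + RtoC (IZR k) * RtoC t) by ring.
        rewrite cis_add, cis_opp; field; apply cis_neq_0.
      + apply (entire_cont_path
          (fun s => f s * cis (- RtoC (IZR (- k)) * s))).
        apply entire_mult_cis, Hf. }
  assert (ZN : forall (N : nat) (k : Z),
    CInt (fun t => g t * RtoC (bump t ^ N) * cis (RtoC (IZR k) * RtoC t)) = 0).
  { induction N as [|N IH]; intros k.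
    - rewrite <- (Z0 k); apply CInt_ext; intros t; simpl; ring.
    - assert (Hc : forall k : Z, cont_path
        (fun t => g t * RtoC (bump t ^ N) * cis (RtoC (IZR k) * RtoC t)))
        by (intros; apply cont_path_mult;
            [apply cont_path_mult; [exact Hg | apply Hbump] | apply Hcis]).
      rewrite (CInt_ext _ (fun t =>
        / 2 * (g t * RtoC (bump t ^ N) * cis (RtoC (IZR k) * RtoC t))
        + (- / 4 * (g t * RtoC (bump t ^ N) * cis (RtoC (IZR (k + 1)) * RtoC t))
        + - / 4 * (g t * RtoC (bump t ^ N) * cis (RtoC (IZR (k - 1)) * RtoC t))))).
      + pose proof (Hc k) as H1; pose proof (Hc (k + 1)%Z) as H2.
        pose proof (Hc (k - 1)%Z) as H3.
        rewrite CInt_plus, CInt_plus, !CInt_scal by solve_cont_path.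
        rewrite !IH; ring.
      + intros t; simpl pow; rewrite RtoC_mult, bump_cis.
        rewrite minus_IZR, plus_IZR, RtoC_minus, RtoC_plus.
        replace ((RtoC (IZR k) + 1) * RtoC t) with
          (RtoC (IZR k) * RtoC t + RtoC t) by ring.
        replace ((RtoC (IZR k) - 1) * RtoC t) with
          (RtoC (IZR k) * RtoC t + - RtoC t) by ring.
        rewrite !cis_add; ring. }
  assert (ZR : forall N : nat, CInt (fun t => g t * RtoC (bump t ^ N)) = 0).
  { intros N; rewrite <- (ZN N 0%Z); apply CInt_ext; intros t.
    rewrite Cmult_0_l, cis_0; ring. }
  destruct (entire_bounded f (Cmod w + 1)%R Hf) as [M [HM KM]].
  assert (Hgb : forall t, (0 <= t <= 1)%R -> (Cmod (g t) <= M)%R).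
  { intros t Ht; apply KM; eapply Rle_trans; [apply Cmod_triangle|].
    rewrite Cmod_R, Rabs_pos_eq; lra. }
  assert (E : f v = g (1 / 2)%R).
  { unfold g, w; f_equal; rewrite RtoC_div by lra; field. }
  rewrite E; apply C_eq; simpl.
  - apply (bump_moments_zero (fun t => Re (g t)) M).
    + intros t; exact (proj1 (Hg t)).
    + intros t Ht; eapply Rle_trans; [apply re_le_Cmod | auto].
    + intros N; specialize (ZR N); apply (f_equal Re) in ZR; simpl in ZR.
      etransitivity; [|exact ZR]; apply RInt_ext; intros t _.
      change (Re (g t) * bump t ^ N = Re (g t) * bump t ^ N - Im (g t) * 0)%R.
      ring.
  - apply (bump_moments_zero (fun t => Im (g t)) M).
    + intros t; exact (proj2 (Hg t)).
    + intros t Ht; eapply Rle_trans; [apply Im_le_Cmod | auto].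
    + intros N; specialize (ZR N); apply (f_equal Im) in ZR; simpl in ZR.
      etransitivity; [|exact ZR]; apply RInt_ext; intros t _.
      change (Im (g t) * bump t ^ N = Re (g t) * 0 + Im (g t) * bump t ^ N)%R.
      ring.
Qed.

(** * Quasi-periodic functions and the three-term identity *)

Definition quasi_periodic (tau kap : C) (m : Z) (f : C -> C) : Prop :=
  forall v, f (v + 1) = f v /\
            f (v + tau) = kap * cis (- RtoC (IZR m) * v) * f v.

(** The coefficient is evaluated on the segment starting at [tau] instead of 0; quasi-periodicity
    brings it back and shifts the mode by [m]. *)
Lemma fourier_step (tau kap : C) (m : Z) (f : C -> C) (k : Z) :
  entire f -> quasi_periodic tau kap m f ->
  fourier f k 0 = kap * cis (- RtoC (IZR k) * tau) * fourier f (k + m) 0.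
Proof.
  intros Hf Hq.
  rewrite <- (fourier_const f k tau Hf (fun w => proj1 (Hq w))).
  unfold fourier; rewrite <- CInt_scal.
  - apply CInt_ext; intros t.
    replace (tau + RtoC t) with (RtoC t + tau) by ring.
    rewrite (proj2 (Hq (RtoC t))), plus_IZR, RtoC_plus, !Cplus_0_l.
    replace (- RtoC (IZR k) * (RtoC t + tau)) with
      (- RtoC (IZR k) * tau + - RtoC (IZR k) * RtoC t) by ring.
    replace (- (RtoC (IZR k) + RtoC (IZR m)) * RtoC t) with
      (- RtoC (IZR m) * RtoC t + - RtoC (IZR k) * RtoC t) by ring.
    rewrite !cis_add; ring.
  - apply (entire_cont_path (fun s => f s * cis (- RtoC (IZR (k + m)) * s))).
    apply entire_mult_cis, Hf.
Qed.

Lemma entire_scal (c : C) (f : C -> C) : entire f -> entire (fun v => c * f v).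
Proof. intros Hf; apply entire_mult; [apply entire_const | exact Hf]. Qed.

Lemma quasi_periodic_plus (tau kap : C) (m : Z) (f g : C -> C) :
  quasi_periodic tau kap m f -> quasi_periodic tau kap m g ->
  quasi_periodic tau kap m (fun v => f v + g v).
Proof.
  intros Hf Hg v; destruct (Hf v) as [F1 F2], (Hg v) as [G1 G2].
  rewrite F1, F2, G1, G2; split; ring.
Qed.

Lemma quasi_periodic_scal (tau kap c : C) (m : Z) (f : C -> C) :
  quasi_periodic tau kap m f -> quasi_periodic tau kap m (fun v => c * f v).
Proof.
  intros Hf v; destruct (Hf v) as [F1 F2]; rewrite F1, F2; split; ring.
Qed.

Lemma fourier_plus (f g : C -> C) (k : Z) (v : C) : entire f -> entire g ->
  fourier (fun w => f w + g w) k v = fourier f k v + fourier g k v.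
Proof.
  intros Hf Hg; unfold fourier; rewrite <- CInt_plus.
  - apply CInt_ext; intros t; ring.
  - apply (entire_cont_path (fun s => f s * cis (- RtoC (IZR k) * s))).
    apply entire_mult_cis, Hf.
  - apply (entire_cont_path (fun s => g s * cis (- RtoC (IZR k) * s))).
    apply entire_mult_cis, Hg.
Qed.

Lemma fourier_scal (c : C) (f : C -> C) (k : Z) (v : C) : entire f ->
  fourier (fun w => c * f w) k v = c * fourier f k v.
Proof.
  intros Hf; unfold fourier; rewrite <- CInt_scal.
  - apply CInt_ext; intros t; ring.
  - apply (entire_cont_path (fun s => f s * cis (- RtoC (IZR k) * s))).
    apply entire_mult_cis, Hf.
Qed.

Lemma quasi_periodic_zero (tau kap : C) (m : Z) (f : C -> C) :
  (0 < m)%Z -> kap <> 0 -> entire f -> quasi_periodic tau kap m f ->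
  (forall k, (0 <= k < m)%Z -> fourier f k 0 = 0) -> forall v, f v = 0.
Proof.
  intros Hm Hk Hf Hq H0; apply fourier_zero; [exact Hf|]; intros k v.
  rewrite (fourier_const f k v Hf (fun w => proj1 (Hq w))).
  assert (S1 : forall j, fourier f (j + m) 0 = 0 -> fourier f j 0 = 0).
  { intros j Hj; rewrite (fourier_step tau kap m f j Hf Hq), Hj; ring. }
  assert (S2 : forall j, fourier f j 0 = 0 -> fourier f (j + m) 0 = 0).
  { intros j Hj; rewrite (fourier_step tau kap m f j Hf Hq) in Hj.
    set (c := kap * cis (- RtoC (IZR j) * tau)) in *.
    assert (Hc : c <> 0) by (apply Cmult_neq_0; [exact Hk | apply cis_neq_0]).
    replace (fourier f (j + m) 0) with (c * fourier f (j + m) 0 / c)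
      by (field; exact Hc).
    rewrite Hj; field; exact Hc. }
  assert (S : forall q j, (0 <= j < m)%Z -> fourier f (j + q * m) 0 = 0).
  { induction q as [|q IH|q IH] using Z.peano_ind; intros j Hj.
    - replace (j + 0 * m)%Z with j by lia; auto.
    - replace (j + Z.succ q * m)%Z with (j + q * m + m)%Z by lia; auto.
    - apply S1; replace (j + Z.pred q * m + m)%Z with (j + q * m)%Z by lia.
      auto. }
  rewrite (Z.div_mod k m) by lia.
  rewrite Z.add_comm, Z.mul_comm; apply S, Z.mod_pos_bound, Hm.
Qed.

(** With [a] and [b] the zeroth coefficients of [f] and [g], the combination [b * f - a * g] has
    zeroth coefficient 0 and hence vanishes. The cross-multiplied form also covers [b = 0], where
    [g] is identically zero. *)
Lemma quasi_periodic1_proportional (tau kap : C) (f g : C -> C) (v w : C) :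
  kap <> 0 -> entire f -> entire g ->
  quasi_periodic tau kap 1 f -> quasi_periodic tau kap 1 g ->
  f v * g w = f w * g v.
Proof.
  intros Hk Hf Hg Qf Qg.
  set (a := fourier f 0 0); set (b := fourier g 0 0).
  assert (Zr : forall s, b * f s + - a * g s = 0).
  { apply (quasi_periodic_zero tau kap 1); try lia; auto.
    - apply entire_plus; apply entire_scal; assumption.
    - apply quasi_periodic_plus; apply quasi_periodic_scal; assumption.
    - intros k Hk0; replace k with 0%Z by lia.
      rewrite fourier_plus by (apply entire_scal; assumption).
      rewrite !fourier_scal by assumption; fold a b; ring. }
  assert (K : forall h : C -> C, entire h -> quasi_periodic tau kap 1 h ->
    fourier h 0 0 = 0 -> forall s, h s = 0).
  { intros h Hh Qh H0; apply (quasi_periodic_zero tau kap 1); try lia; auto.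
    intros k Hk0; replace k with 0%Z by lia; exact H0. }
  destruct (Ceq_dec b 0) as [Hb | Hb].
  - rewrite (K g Hg Qg Hb v), (K g Hg Qg Hb w); ring.
  - assert (E : forall s, f s = a / b * g s).
    { intros s; replace (f s) with ((b * f s + - a * g s + a * g s) / b)
        by (field; exact Hb).
      rewrite Zr; field; exact Hb. }
    rewrite (E v), (E w); ring.
Qed.

(** The three pairs of coefficients with indices 0 and 1 lie in a plane, so they satisfy a
    nontrivial relation, which the functions inherit; the columns of the matrix of values are then
    dependent. *)
Lemma quasi_periodic2_det (tau kap : C) (f g h : C -> C) (u v w : C) :
  kap <> 0 -> entire f -> entire g -> entire h ->
  quasi_periodic tau kap 2 f -> quasi_periodic tau kap 2 g ->
  quasi_periodic tau kap 2 h ->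
  f u * (g v * h w - g w * h v) - g u * (f v * h w - f w * h v)
  + h u * (f v * g w - f w * g v) = 0.
Proof.
  intros Hk Hf Hg Hh Qf Qg Qh.
  assert (K : forall a b c : C,
    a * fourier f 0 0 + b * fourier g 0 0 + c * fourier h 0 0 = 0 ->
    a * fourier f 1 0 + b * fourier g 1 0 + c * fourier h 1 0 = 0 ->
    forall s, a * f s + b * g s + c * h s = 0).
  { intros a b c H0 H1.
    apply (quasi_periodic_zero tau kap 2); try lia; auto.
    - repeat apply entire_plus; apply entire_scal; assumption.
    - repeat apply quasi_periodic_plus; apply quasi_periodic_scal; assumption.
    - intros k Hk0.
      rewrite fourier_plus, fourier_plus, !fourier_scal;
        try (repeat apply entire_plus; try apply entire_scal; assumption).
      assert (E : k = 0%Z \/ k = 1%Z) by lia; destruct E; subst k; assumption. }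
  set (p := fourier f 0 0) in *; set (p' := fourier f 1 0) in *.
  set (q := fourier g 0 0) in *; set (q' := fourier g 1 0) in *.
  set (r := fourier h 0 0) in *; set (r' := fourier h 1 0) in *.
  assert (Det : forall a b c : C, (a <> 0 \/ b <> 0 \/ c <> 0) ->
    (forall s, a * f s + b * g s + c * h s = 0) ->
    f u * (g v * h w - g w * h v) - g u * (f v * h w - f w * h v)
    + h u * (f v * g w - f w * g v) = 0).
  { intros a b c Habc R.
    set (D := f u * (g v * h w - g w * h v) - g u * (f v * h w - f w * h v)
              + h u * (f v * g w - f w * g v)).
    (* Cramer's rule: each coefficient of the relation times [D] combines the relation at [u], [v],
       [w] with cofactors as weights. *)
    assert (C1 : a * D = 0).
    { transitivity ((a * f u + b * g u + c * h u) * (g v * h w - g w * h v)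
        - (a * f v + b * g v + c * h v) * (g u * h w - g w * h u)
        + (a * f w + b * g w + c * h w) * (g u * h v - g v * h u));
        [unfold D; ring | rewrite !R; ring]. }
    assert (C2 : b * D = 0).
    { transitivity (- ((a * f u + b * g u + c * h u) * (f v * h w - f w * h v)
        - (a * f v + b * g v + c * h v) * (f u * h w - f w * h u)
        + (a * f w + b * g w + c * h w) * (f u * h v - f v * h u)));
        [unfold D; ring | rewrite !R; ring]. }
    assert (C3 : c * D = 0).
    { transitivity ((a * f u + b * g u + c * h u) * (f v * g w - f w * g v)
        - (a * f v + b * g v + c * h v) * (f u * g w - f w * g u)
        + (a * f w + b * g w + c * h w) * (f u * g v - f v * g u));
        [unfold D; ring | rewrite !R; ring]. }
    assert (N : forall x : C, x <> 0 -> x * D = 0 -> D = 0).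
    { intros x Hx E; replace D with (x * D / x) by (field; exact Hx).
      rewrite E; field; exact Hx. }
    destruct Habc as [Ha | [Hb | Hc]]; eauto. }
  (* The relation is the cross product of [(p, q, r)] and [(p', q', r')]. If its first entry
     vanishes, the coefficient pairs of [g] and [h] are parallel and a relation between these two
     functions suffices. *)
  destruct (Ceq_dec (q * r' - r * q') 0) as [E1 | E1];
    [|apply (Det (q * r' - r * q') (r * p' - p * r') (p * q' - q * p'));
      [auto | apply K; ring]].
  destruct (Ceq_dec q 0) as [Eq | Eq].
  - destruct (Ceq_dec q' 0) as [Eq' | Eq'].
    + apply (Det 0 1 0); [right; left; apply C1_nz|].
      apply K; [rewrite Eq | rewrite Eq']; ring.
    + apply (Det 0 (- r') q'); [auto|].
      apply K; [|ring].
      replace (0 * p + - r' * q + q' * r) with (- (q * r' - r * q')) by ring.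
      rewrite E1; ring.
  - apply (Det 0 (- r) q); [auto|].
    apply K; [ring|].
    replace (0 * p' + - r * q' + q * r') with (q * r' - r * q') by ring.
    exact E1.
Qed.

Lemma entire_nome_theta_mul (tau a b : C) : (0 < Im tau)%R ->
  entire (fun v => nome_theta tau (a * v + b)).
Proof.
  intros Ht; unfold nome_theta, jtheta.
  pose proof (Cmod_cis_lt_1 tau Ht) as Hq.
  apply entire_mult; [|apply entire_mult].
  - apply entire_ext with (fun v => cis (- (a / 2) * v + - (b / 2))).
    + intros v; f_equal; field.
    + apply hol_entire, hol_cis_affine.
  - apply entire_ext with (fun v => qprod (cis tau) (1 * cis (a * v + b))).
    + intros v; f_equal; ring.
    + apply entire_qprod, Hq.
  - apply entire_ext with
      (fun v => qprod (cis tau) (cis tau * cis (- a * v + - b))).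
    + intros v; f_equal.
      replace (- a * v + - b) with (- (a * v + b)) by ring.
      rewrite cis_opp; reflexivity.
    + apply entire_qprod, Hq.
Qed.

Section Weierstrass.

Variable tau : C.
Hypothesis Htau : (0 < Im tau)%R.

Definition theta_pair (x y : C) : C :=
  nome_theta tau (x + y) * nome_theta tau (x - y).

Lemma theta_pair_antisym (x y : C) : theta_pair y x = - theta_pair x y.
Proof.
  unfold theta_pair; rewrite (Cplus_comm y x).
  replace (y - x) with (- (x - y)) by ring.
  rewrite nome_theta_opp by exact Htau; ring.
Qed.

Lemma theta_pair_entire (y : C) : entire (fun x => theta_pair x y).
Proof.
  apply entire_mult.
  - apply entire_ext with (fun x => nome_theta tau (1 * x + y)).
    + intros x; f_equal; ring.
    + apply entire_nome_theta_mul, Htau.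
  - apply entire_ext with (fun x => nome_theta tau (1 * x + - y)).
    + intros x; f_equal; ring.
    + apply entire_nome_theta_mul, Htau.
Qed.

(** The contributions of [y] to the two multipliers cancel, so all functions [theta_pair _ y] lie in
    one two-dimensional space; this is the rank-two property. *)
Lemma theta_pair_quasi_periodic (y : C) :
  quasi_periodic tau (cis (- tau)) 2 (fun x => theta_pair x y).
Proof.
  intros x; unfold theta_pair; split.
  - replace (x + 1 + y) with (x + y + 1) by ring.
    replace (x + 1 - y) with (x - y + 1) by ring.
    rewrite !nome_theta_add1 by exact Htau; ring.
  - replace (x + tau + y) with (x + y + tau) by ring.
    replace (x + tau - y) with (x - y + tau) by ring.
    rewrite !nome_theta_addtau by exact Htau.
    replace (cis (- tau) * cis (- RtoC (IZR 2) * x)) with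
      (cis (- (x + y) - tau / 2) * cis (- (x - y) - tau / 2)); [ring|].
    rewrite <- !cis_add; f_equal; field.
Qed.

Lemma theta_pair_diag (x : C) : theta_pair x x = 0.
Proof.
  pose proof (theta_pair_antisym x x) as H.
  replace (theta_pair x x) with ((theta_pair x x + theta_pair x x) / 2)
    by field.
  rewrite H at 1; field.
Qed.

(* An antisymmetric kernel of rank two has vanishing 3x3 minors; those of a
   4x4 antisymmetric matrix are its Pfaffian times an entry. *)
Lemma theta_three_term (x y z w : C) :
  theta_pair x y * theta_pair z w - theta_pair x z * theta_pair y w
  + theta_pair x w * theta_pair y z = 0.
Proof.
  pose proof theta_pair_antisym as A.
  assert (Det : forall a b c u v t,
    theta_pair u a * (theta_pair v b * theta_pair t c
                      - theta_pair t b * theta_pair v c)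
    - theta_pair u b * (theta_pair v a * theta_pair t c
                        - theta_pair t a * theta_pair v c)
    + theta_pair u c * (theta_pair v a * theta_pair t b
                        - theta_pair t a * theta_pair v b) = 0).
  { intros; apply (quasi_periodic2_det tau (cis (- tau))
      (fun x => theta_pair x a) (fun x => theta_pair x b)
      (fun x => theta_pair x c));
    auto using cis_neq_0, theta_pair_entire, theta_pair_quasi_periodic. }
  set (P := theta_pair x y * theta_pair z w - theta_pair x z * theta_pair y w
            + theta_pair x w * theta_pair y z).
  assert (N : forall c : C, c <> 0 -> c * P = 0 -> P = 0).
  { intros c Hc E; replace P with (c * P / c) by (field; exact Hc).
    rewrite E; field; exact Hc. }
  destruct (Ceq_dec (theta_pair x y) 0) as [Exy | Exy].
  (* The Pfaffian is obtained by dividing a minor by a nonzero entry of the row of [x]; if that row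
     vanishes, every term contains one of its entries. *)
  - destruct (Ceq_dec (theta_pair x z) 0) as [Exz | Exz].
    + destruct (Ceq_dec (theta_pair x w) 0) as [Exw | Exw].
      * unfold P; rewrite Exy, Exz, Exw; ring.
      * apply (N _ Exw); rewrite <- (Det x w y w x z); unfold P.
        rewrite !theta_pair_diag, ?(A x y), ?(A x z), ?(A x w), ?(A y z), ?(A y w),
          ?(A z w); ring.
    + apply (N _ Exz); rewrite <- (Det x z y x z w); unfold P.
      rewrite !theta_pair_diag, ?(A x y), ?(A x z), ?(A x w), ?(A y z), ?(A y w),
        ?(A z w); ring.
  - apply (N _ Exy); rewrite <- (Det x y z y x w); unfold P.
    rewrite !theta_pair_diag, ?(A x y), ?(A x z), ?(A x w), ?(A y z), ?(A y w),
      ?(A z w); ring.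
Qed.

End Weierstrass.

(** * The scalar factor *)

Lemma Im_upper_neq_0 (t : C) : (0 < Im t)%R -> t <> 0.
Proof. intros H E; rewrite E in H; simpl in H; lra. Qed.

Lemma Im_opp_inv (t : C) : (0 < Im t)%R -> (0 < Im (- / t))%R.
Proof.
  intros H; destruct t as [a b]; simpl in *.
  assert (Hd : (0 < a * (a * 1) + b * (b * 1))%R) by nra.
  replace (- (- b / (a * (a * 1) + b * (b * 1))))%R with
    (b / (a * (a * 1) + b * (b * 1)))%R by (field; lra).
  apply Rdiv_lt_0_compat; assumption.
Qed.

(** The right-hand side of Jacobi's imaginary transformation without its constant; the Gaussian
    compensates for the exchange of the two periods. *)
Definition modular_theta (tau v : C) : C :=
  cis (- (v * v) / (2 * tau)) * nome_theta (- / tau) (- v / tau).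

(* Both sides of Jacobi's imaginary transformation, times [cis (v / 2)], are
   quasi-periodic of level one, hence proportional. *)
Lemma nome_theta_modular (tau v w : C) : (0 < Im tau)%R ->
  nome_theta tau v * modular_theta tau w
  = nome_theta tau w * modular_theta tau v.
Proof.
  intros Ht.
  pose proof (Im_upper_neq_0 tau Ht) as Ht0.
  pose proof (Im_opp_inv tau Ht) as Hs.
  set (sg := - / tau) in *.
  assert (Hhalf : entire (fun v => cis (v / 2))).
  { apply entire_ext with (fun v => cis (/ 2 * v + 0)).
    - intros s; f_equal; field.
    - apply hol_entire, hol_cis_affine. }
  assert (Ef : entire (fun v => cis (v / 2) * nome_theta tau v)).
  { apply entire_mult; [exact Hhalf|].
    apply entire_ext with (fun v => nome_theta tau (1 * v + 0)).
    - intros s; f_equal; ring.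
    - apply entire_nome_theta_mul, Ht. }
  assert (Eg : entire (fun v => cis (v / 2) * modular_theta tau v)).
  { apply entire_mult; [exact Hhalf|]; unfold modular_theta.
    apply entire_mult.
    - apply entire_ext with (fun v => cis (- / (2 * tau) * (v * v) + 0 * v + 0)).
      + intros s; f_equal; field; exact Ht0.
      + apply hol_entire, hol_cis_quadratic.
    - apply entire_ext with (fun v => nome_theta sg (- / tau * v + 0)).
      + intros s; fold sg; f_equal; unfold sg; field; exact Ht0.
      + apply entire_nome_theta_mul, Hs. }
  assert (Hhalf1 : forall s, cis ((s + 1) / 2) = - cis (s / 2)).
  { intros s; replace ((s + 1) / 2) with (s / 2 + 1 / 2) by field.
    rewrite cis_add, cis_half; ring. }
  assert (Qf : quasi_periodic tau (- (1)) 1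
                 (fun v => cis (v / 2) * nome_theta tau v)).
  { intros s; split.
    - rewrite Hhalf1, nome_theta_add1 by exact Ht; ring.
    - rewrite nome_theta_addtau by exact Ht.
      replace (cis ((s + tau) / 2)) with
        (cis (- RtoC (IZR 1) * s) * cis (s / 2) * / cis (- s - tau / 2)).
      + field; apply cis_neq_0.
      + rewrite <- cis_opp, <- !cis_add; f_equal; field. }
  assert (Qg : quasi_periodic tau (- (1)) 1
                 (fun v => cis (v / 2) * modular_theta tau v)).
  { intros s; unfold modular_theta; fold sg; split.
    - rewrite Hhalf1.
      replace (- (s + 1) / tau) with (- s / tau + sg)
        by (unfold sg; field; exact Ht0).
      rewrite nome_theta_addtau by exact Hs.
      replace (cis (- ((s + 1) * (s + 1)) / (2 * tau))) with
        (cis (- (s * s) / (2 * tau)) * / cis (- (- s / tau) - sg / 2)).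
      + field; apply cis_neq_0.
      + rewrite <- cis_opp, <- cis_add; f_equal; unfold sg; field; exact Ht0.
    - replace (- s / tau) with (- (s + tau) / tau + 1) by (field; exact Ht0).
      rewrite nome_theta_add1 by exact Hs.
      replace (cis ((s + tau) / 2) * (cis (- ((s + tau) * (s + tau)) / (2 * tau))
                 * nome_theta sg (- (s + tau) / tau))) with
        (cis ((s + tau) / 2 + - ((s + tau) * (s + tau)) / (2 * tau))
         * nome_theta sg (- (s + tau) / tau)) by (rewrite cis_add; ring).
      replace ((s + tau) / 2 + - ((s + tau) * (s + tau)) / (2 * tau)) with
        (- RtoC (IZR 1) * s + (s / 2 + - (s * s) / (2 * tau)))
        by (field; exact Ht0).
      rewrite !cis_add; ring. }
  pose proof (quasi_periodic1_proportional tau (- (1)) _ _ v w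
    ltac:(intros E; apply C1_nz; replace (RtoC 1) with (- - (1)) by ring;
          rewrite E; ring) Ef Eg Qf Qg) as H; cbv beta in H.
  pose proof (cis_neq_0 (v / 2)) as Nv; pose proof (cis_neq_0 (w / 2)) as Nw.
  replace (nome_theta tau v * modular_theta tau w) with
    (cis (v / 2) * nome_theta tau v * (cis (w / 2) * modular_theta tau w)
     / (cis (v / 2) * cis (w / 2))) by (field; auto).
  rewrite H; field; auto.
Qed.

(* [Q] is (.; x^4, p)_oo, [L] is (.; p)_oo, and [x] stands for x^2. *)
Lemma double_product_cancel (Q L : C -> C) (p x z : C) :
  (forall s, Q s = L s * Q (s * (x * x))) ->
  x <> 0 -> z <> 0 ->
  Q (p * x / (x * z)) * Q (x / (x * z)) * Q (p * (x * z))
  * Q (x * x * (x * z)) <> 0 ->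
  Q (p * x / z) * Q (x / z) * Q (p * z) * Q (x * x * z) <> 0 ->
  Q (p * x * (x * z)) * Q (x * (x * z)) * Q (p / (x * z)) * Q (x * x / (x * z))
  / (Q (p * x / (x * z)) * Q (x / (x * z)) * Q (p * (x * z))
     * Q (x * x * (x * z)))
  * (Q (p * x * z) * Q (x * z) * Q (p / z) * Q (x * x / z)
     / (Q (p * x / z) * Q (x / z) * Q (p * z) * Q (x * x * z)))
  = L (x * z) * L (p / (x * z)) / (L (/ z) * L (p * z))
  /\ L (/ z) * L (p * z) <> 0.
Proof.
  intros HQ Hx Hz.
  replace (p * x / (x * z)) with (p / z) by (field; auto).
  replace (x / (x * z)) with (/ z) by (field; auto).
  replace (x * x / (x * z)) with (x / z) by (field; auto).
  replace (p * (x * z)) with (p * x * z) by ring.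
  replace (x * (x * z)) with (x * x * z) by ring.
  (* Four factors of the numerator already occur in the denominator. Each of the four expanded here
     differs by the shift [x * x] from one of the rest on the other side of the fraction. *)
  rewrite (HQ (/ z)), (HQ (p * z)), (HQ (x * z)), (HQ (p / (x * z))).
  replace (/ z * (x * x)) with (x * x / z) by (field; auto).
  replace (p * z * (x * x)) with (p * x * (x * z)) by ring.
  replace (x * z * (x * x)) with (x * x * (x * z)) by ring.
  replace (p / (x * z) * (x * x)) with (p * x / z) by (field; auto).
  intros N1 N2.
  assert (S : forall a b, a * b <> 0 -> a <> 0 /\ b <> 0).
  { intros a b H; split; intros E; apply H; rewrite E; ring. }
  repeat match goal with
         | H : _ * _ <> RtoC 0 |- _ => apply S in H; destruct H
         end.
  split; [field; repeat split; assumption | apply Cmult_neq_0; assumption].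
Qed.

Lemma xpow_add (K lam s t : C) :
  xpow K lam (s + t) = xpow K lam s * xpow K lam t.
Proof. unfold xpow; rewrite <- Cexp_add; f_equal; ring. Qed.

Lemma xpow_neq_0 (K lam s : C) : xpow K lam s <> 0.
Proof. apply Cexp_neq_0. Qed.

Lemma Cmod_xpow_4 (K lam : C) :
  (Cmod (xpow K lam 1) < 1)%R -> (Cmod (xpow K lam 4) < 1)%R.
Proof.
  intros H.
  replace (xpow K lam 4) with (xpow K lam 1 ^ 4).
  - rewrite Cmod_pow; pose proof (Cmod_ge_0 (xpow K lam 1)).
    set (a := Cmod (xpow K lam 1)) in *.
    assert (a * a < 1)%R by nra.
    replace (a ^ 4)%R with ((a * a) * (a * a))%R by ring; nra.
  - unfold xpow; rewrite Cexp_pow; f_equal; simpl INR.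
    replace (RtoC (1 + 1 + 1 + 1)) with (RtoC 4) by (f_equal; ring); ring.
Qed.

Lemma qpoch_step (K K' lam z : C) :
  (Cmod (p_par K K') < 1)%R -> (Cmod (xpow K lam 1) < 1)%R ->
  qpoch K K' lam z
  = qprod (p_par K K') z * qpoch K K' lam (z * xpow K lam 4).
Proof.
  intros Hp Hx; apply Cmod_xpow_4 in Hx.
  unfold qpoch; set (x4 := xpow K lam 4) in *; set (p := p_par K K') in *.
  change (Cinfprod (fun m => qprod p (z * x4 ^ m))
          = qprod p z * Cinfprod (fun m => qprod p (z * x4 * x4 ^ m))).
  assert (Hr : (0 <= Cmod p < 1)%R) by (split; [apply Cmod_ge_0 | exact Hp]).
  assert (Hr4 : (0 <= Cmod x4 < 1)%R) by (split; [apply Cmod_ge_0 | exact Hx]).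
  apply prod_to_Cinfprod.
  replace (qprod p z) with (qprod p (z * x4 ^ 0)) by (f_equal; simpl; ring).
  apply (prod_to_shift (fun m => qprod p (z * x4 ^ m))).
  apply prod_to_ext with (fun m => qprod p (z * x4 * x4 ^ m)).
  { intros m; f_equal; rewrite Cpow_S; ring. }
  set (w := z * x4).
  set (B := (exp (Cmod w / (1 - Cmod p)) * / (1 - Cmod p) * Cmod w)%R).
  assert (Hi : (0 < / (1 - Cmod p))%R) by (apply Rinv_0_lt_compat; lra).
  apply (Cprod_geom_cv _ B (Cmod x4) Hr4).
  - unfold B; pose proof (exp_pos (Cmod w / (1 - Cmod p))).
    pose proof (Cmod_ge_0 w); repeat apply Rmult_le_pos; lra.
  - intros m.
    (* The partial product with [N = 0] is 1, so the tail estimate there bounds the deviation of the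
       [m]-th inner product from 1. *)
    destruct (qprod_cv p (w * x4 ^ m) Hp) as [_ H]; specialize (H O).
    simpl Cprod in H; rewrite Rmult_1_r, Cmod_sub_comm in H.
    eapply Rle_trans; [exact H|].
    unfold geom_const; rewrite Cmod_mult, Cmod_pow.
    set (y := (Cmod x4 ^ m)%R).
    assert (Hy : (0 <= y <= 1)%R).
    { split; [apply pow_le; lra|].
      unfold y; rewrite <- (pow1 m); apply pow_incr; lra. }
    pose proof (Cmod_ge_0 w) as Hw.
    assert (Hwy : (0 <= Cmod w * y <= Cmod w)%R) by nra.
    assert (He : (exp (Cmod w * y / (1 - Cmod p))
                  <= exp (Cmod w / (1 - Cmod p)))%R).
    { apply exp_monotone, Rmult_le_compat_r; lra. }
    unfold B; rewrite !Rmult_assoc.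
    apply Rmult_le_compat; [left; apply exp_pos | | exact He |].
    + apply Rmult_le_pos; lra.
    + unfold Rdiv; rewrite (Rmult_comm (/ (1 - Cmod p))); right; ring.
Qed.

Section Scalar_factor.

Variables K K' lam : C.
Hypothesis htau : (0 < Im (tau K K'))%R.
Hypothesis hx : (Cmod (xpow K lam 1) < 1)%R.

Lemma nonzero_parameters : K <> 0 /\ K' <> 0 /\ lam <> 0.
Proof.
  (* With the convention [/ 0 = 0], [K' = 0] would make [tau] zero; [lam = 0] would give [x = 1]. *)
  assert (I0 : / RtoC 0 = 0).
  { unfold Cinv; apply C_eq; simpl; unfold Rdiv; ring. }
  repeat split; intros E; subst.
  - revert htau; unfold tau, Cdiv; rewrite Cmult_0_r, Cmult_0_l; simpl; lra.
  - revert htau; unfold tau, Cdiv; rewrite I0, Cmult_0_r; simpl; lra.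
  - revert hx; unfold xpow, Cdiv.
    replace (- (PI * 0 * / (2 * K)) * 1) with (RtoC 0) by ring.
    rewrite Cexp_0, Cmod_1; lra.
Qed.

Lemma r_par_neq_0 : r_par K' lam <> 0.
Proof.
  destruct nonzero_parameters as [HK [HK' Hl]].
  intros E; apply HK'; replace K' with (r_par K' lam * lam)
    by (unfold r_par; field; exact Hl); rewrite E; ring.
Qed.

(** So [p] is the nome at [- / tau], and the modular transformation carries [[u]] to the products in
    [R0]. *)
Lemma p_par_cis : p_par K K' = cis (- / tau K K').
Proof.
  destruct nonzero_parameters as [HK [HK' Hl]].
  unfold p_par, cis, tau; f_equal; field; auto using Ci_neq_0.
Qed.

Lemma Cmod_p_par : (Cmod (p_par K K') < 1)%R.
Proof. rewrite p_par_cis; apply Cmod_cis_lt_1, Im_opp_inv, htau. Qed.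

(** The Gaussian and the prefactor of [nome_theta] combine into one power of [x], because
    [Ci / tau = K' / (2 * K)]. *)
Lemma modular_theta_xpow (u : C) :
  modular_theta (tau K K') (u / r_par K' lam)
  = xpow K lam (u * u / r_par K' lam - u)
    * jtheta (p_par K K') (xpow K lam (2 * u)).
Proof.
  destruct nonzero_parameters as [HK [HK' Hl]].
  unfold modular_theta, nome_theta; rewrite <- p_par_cis.
  replace (cis (- (u / r_par K' lam) / tau K K')) with (xpow K lam (2 * u)).
  - rewrite Cmult_assoc; f_equal; rewrite <- cis_add.
    assert (Et : Ci / tau K K' = K' / (2 * K))
      by (unfold tau; field; auto using Ci_neq_0).
    pose proof (Im_upper_neq_0 _ htau) as Ht.
    set (v := u / r_par K' lam).
    unfold xpow, cis; f_equal.
    transitivity (PI * (Ci / tau K K') * (v - v * v)); [field; exact Ht|].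
    rewrite Et; unfold v, r_par; field; auto.
  - unfold xpow, cis, r_par, tau; f_equal; field; auto using Ci_neq_0.
Qed.

Lemma R21_0_jtheta (u : C) :
  R0_den K K' lam (u + 1) <> 0 -> R0_den K K' lam u <> 0 ->
  let z := xpow K lam (2 * u) in
  R21_0 K K' lam u
  = xpow K lam (- (2 * u + 1) * ((r_par K' lam - 1) / r_par K' lam))
    * (jtheta (p_par K K') (xpow K lam 2 * z) / jtheta (p_par K K') (/ z))
  /\ jtheta (p_par K K') (/ z) <> 0.
Proof.
  intros H1 H0 z.
  pose proof r_par_neq_0 as Hr.
  pose proof (xpow_neq_0 K lam (2 * u)) as Hz; fold z in Hz.
  pose proof (xpow_neq_0 K lam 2) as Hx2.
  assert (Ez : xpow K lam (2 * (u + 1)) = xpow K lam 2 * z).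
  { unfold z; rewrite <- xpow_add; f_equal; ring. }
  assert (E4 : xpow K lam 4 = xpow K lam 2 * xpow K lam 2).
  { rewrite <- xpow_add; f_equal.
    rewrite <- RtoC_plus; f_equal; ring. }
  assert (HQ : forall s, qpoch K K' lam s = qprod (p_par K K') s
    * qpoch K K' lam (s * (xpow K lam 2 * xpow K lam 2))).
  { intros s; rewrite <- E4; apply qpoch_step; [apply Cmod_p_par | exact hx]. }
  unfold R0_den in H1, H0; rewrite Ez, E4 in H1; rewrite E4 in H0.
  fold z in H0; cbv zeta in H1, H0.
  destruct (double_product_cancel _ _ _ _ _ HQ Hx2 Hz H1 H0) as [E N].
  assert (Ej : jtheta (p_par K K') (/ z)
               = qprod (p_par K K') (/ z) * qprod (p_par K K') (p_par K K' * z)).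
  { unfold jtheta; do 2 f_equal; field; exact Hz. }
  split; [|rewrite Ej; exact N].
  rewrite Ej; unfold jtheta; rewrite <- E.
  unfold R21_0, Defs.R0, R0_num, R0_den; rewrite Ez, E4; fold z; cbv zeta.
  replace (xpow K lam (- (2 * u + 1) * ((r_par K' lam - 1) / r_par K' lam)))
    with (xpow K lam (2 * (u + 1) * - ((r_par K' lam - 1) / (2 * r_par K' lam)))
          * xpow K lam (2 * u * - ((r_par K' lam - 1) / (2 * r_par K' lam)))).
  - unfold Cdiv; ring.
  - rewrite <- xpow_add; f_equal; field; exact Hr.
Qed.

(** With [z] for [x ^ (2 * (u - 1))], inversion turns the denominator of the factor at [u] into a
    multiple of the numerator of the factor at [u - 1]. What remains is [jtheta] at [x ^ 4 * z] over
    [jtheta] at [z], the modular image of the quotient of brackets. *)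
Lemma R22_0_br (u : C) :
  R0_den K K' lam (u + 1) <> 0 -> R0_den K K' lam u <> 0 ->
  R0_den K K' lam (u - 1) <> 0 -> br K K' lam (u - 1) <> 0 ->
  R22_0 K K' lam u = br K K' lam (u + 1) / br K K' lam (u - 1).
Proof.
  intros H1 H0 Hm Hb.
  pose proof r_par_neq_0 as Hr.
  destruct (R21_0_jtheta u H1 H0) as [E1 N1].
  replace u with (u - 1 + 1) in H0 by ring.
  destruct (R21_0_jtheta (u - 1) H0 Hm) as [E0 N0].
  unfold R22_0; rewrite E1, E0.
  set (z := xpow K lam (2 * (u - 1))) in *.
  set (x2 := xpow K lam 2) in *.
  set (p := p_par K K') in *.
  assert (Hz : z <> 0) by apply xpow_neq_0.
  assert (Hx2 : x2 <> 0) by apply xpow_neq_0.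
  assert (Hp : (Cmod p < 1)%R) by apply Cmod_p_par.
  assert (Hp0 : p <> 0) by apply Cexp_neq_0.
  assert (Ez : xpow K lam (2 * u) = x2 * z).
  { unfold x2, z; rewrite <- xpow_add; f_equal; ring. }
  rewrite Ez in *.
  assert (J1 : jtheta p (/ (x2 * z)) = - jtheta p (x2 * z) / (x2 * z))
    by (apply jtheta_inv; auto using Cmult_neq_0).
  assert (J0 : jtheta p (/ z) = - jtheta p z / z)
    by (apply jtheta_inv; auto).
  rewrite J1 in *; rewrite J0 in *.
  assert (Nz : forall a b, - a / b <> 0 -> a <> 0).
  { intros a b H E; apply H; rewrite E; unfold Cdiv; ring. }
  apply Nz in N1; apply Nz in N0.
  set (t := tau K K') in *.
  unfold br in Hb |- *.
  rewrite !vartheta1_nome_theta in * by exact htau; fold t in Hb |- *.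
  set (c := brC0 K K' lam) in *; set (k := vartheta1_const t) in *.
  pose proof (nome_theta_modular t ((u + 1) / r_par K' lam)
                ((u - 1) / r_par K' lam) htau) as M.
  unfold t in M; rewrite !modular_theta_xpow in M; fold t p z in M.
  replace (xpow K lam (2 * (u + 1))) with (x2 * (x2 * z)) in M
    by (unfold x2, z; rewrite <- !xpow_add; f_equal; ring).
  set (Tp := nome_theta t ((u + 1) / r_par K' lam)) in *.
  set (Tm := nome_theta t ((u - 1) / r_par K' lam)) in *.
  assert (Nck : c <> 0 /\ k <> 0 /\ Tm <> 0).
  { repeat split; intros E; apply Hb; rewrite E; ring. }
  destruct Nck as [Nc [Nk NT]].
  set (Xm := xpow K lam ((u - 1) * (u - 1) / r_par K' lam - (u - 1))) in *.
  set (Xp := xpow K lam ((u + 1) * (u + 1) / r_par K' lam - (u + 1))) in *.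
  assert (NXm : Xm <> 0) by apply xpow_neq_0.
  assert (ET : Tp = Tm * (Xp * jtheta p (x2 * (x2 * z))) / (Xm * jtheta p z)).
  { rewrite <- M; field; auto. }
  (* Both sides are the power of [x] with exponent [4 * u / r - 2]; the factors [x2 * z] and [z]
     come from the two inversions of [jtheta]. *)
  assert (EX : Xp / Xm =
    xpow K lam (- (2 * (u - 1) + 1) * ((r_par K' lam - 1) / r_par K' lam))
    * xpow K lam (- (2 * u + 1) * ((r_par K' lam - 1) / r_par K' lam))
    * (x2 * z) * z).
  { replace Xp with (Xm * (xpow K lam (- (2 * (u - 1) + 1)
        * ((r_par K' lam - 1) / r_par K' lam))
      * xpow K lam (- (2 * u + 1) * ((r_par K' lam - 1) / r_par K' lam))
      * (x2 * z) * z)).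
    - field; exact NXm.
    - unfold Xm, Xp, x2, z; rewrite <- !xpow_add; f_equal; field; exact Hr. }
  rewrite ET.
  transitivity (Xp / Xm * jtheta p (x2 * (x2 * z)) / jtheta p z).
  - rewrite EX; field; auto.
  - field; repeat split; auto.
Qed.

End Scalar_factor.

(** * Addition formulas *)

Section Theta_relations.

Variables K K' lam : C.
Hypothesis htau : (0 < Im (tau K K'))%R.
Hypothesis hr : r_par K' lam <> 0.

Let T (v : C) : C := nome_theta (tau K K' / 2) v.
Let c : C := vartheta1_const (tau K K' / 2).

Lemma Im_half : (0 < Im (tau K K' / 2))%R.
Proof.
  replace (tau K K' / 2) with (tau K K' * RtoC (/ 2))
    by (rewrite RtoC_inv by lra; reflexivity).
  rewrite Im_mult; change (Im (RtoC (/ 2))) with 0%R.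
  change (Re (RtoC (/ 2))) with (/ 2)%R; lra.
Qed.

Lemma th1_nome (k : C) : th1 K K' lam k = c * T (k / (2 * r_par K' lam)).
Proof. apply vartheta1_nome_theta, Im_half. Qed.

Lemma th2_nome (k : C) :
  th2 K K' lam k = c * T (k / (2 * r_par K' lam) + 1 / 2).
Proof. apply vartheta1_nome_theta, Im_half. Qed.

Lemma T_sub_half (v : C) : T (v - 1 / 2) = - T (v + 1 / 2).
Proof.
  replace (v + 1 / 2) with (v - 1 / 2 + 1) by field.
  unfold T; rewrite nome_theta_add1 by apply Im_half; ring.
Qed.

Lemma th1_add_sub (x y : C) :
  th1 K K' lam (x + y) * th1 K K' lam (x - y) * th2 K K' lam 0 ^ 2
  = th1 K K' lam x ^ 2 * th2 K K' lam y ^ 2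
    - th2 K K' lam x ^ 2 * th1 K K' lam y ^ 2.
Proof.
  rewrite !th1_nome, !th2_nome.
  set (X := x / (2 * r_par K' lam)); set (Y := y / (2 * r_par K' lam)).
  replace ((x + y) / (2 * r_par K' lam)) with (X + Y)
    by (unfold X, Y; field; exact hr).
  replace ((x - y) / (2 * r_par K' lam)) with (X - Y)
    by (unfold X, Y; field; exact hr).
  replace (0 / (2 * r_par K' lam) + 1 / 2) with (1 / 2) by (field; exact hr).
  (* Pairing with 0 gives the square of [T], and pairing with [1 / 2] gives minus the square of its
     half-period shift, that is, of [theta_2]. *)
  pose proof (theta_three_term _ Im_half X Y (1 / 2) 0) as H.
  unfold theta_pair in H; fold (T (X + Y)) (T (X - Y)) in H.
  rewrite !Cplus_0_r in H.
  fold (T (X - 1 / 2)) (T (X + 1 / 2)) (T (Y - 1 / 2)) (T (Y + 1 / 2)) in H.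
  rewrite !T_sub_half in H.
  replace (1 / 2 - 0) with (1 / 2) in H by field.
  replace (X - 0) with X in H by ring; replace (Y - 0) with Y in H by ring.
  fold (T X) (T Y) (T (1 / 2)) in H.
  transitivity (c ^ 4 * (T (X + Y) * T (X - Y) * (T (1 / 2) * T (1 / 2))
    - T (X + 1 / 2) * - T (X + 1 / 2) * (T Y * T Y)
    + T X * T X * (T (Y + 1 / 2) * - T (Y + 1 / 2)))
    + (c * T X) ^ 2 * (c * T (Y + 1 / 2)) ^ 2
    - (c * T (X + 1 / 2)) ^ 2 * (c * T Y) ^ 2); [ring | rewrite H; ring].
Qed.

Lemma th2_shift (k : C) : th2 K K' lam k = th1 K K' lam (k + r_par K' lam).
Proof. rewrite th1_nome, th2_nome; do 2 f_equal; field; exact hr. Qed.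

(** Together with [th2_shift] this shows that starring is the translation of [u] by [- r_par]. *)
Lemma th2_shift2 (k : C) :
  th2 K K' lam (k + r_par K' lam) = - th1 K K' lam k.
Proof.
  rewrite th1_nome, th2_nome.
  replace ((k + r_par K' lam) / (2 * r_par K' lam) + 1 / 2) with
    (k / (2 * r_par K' lam) + 1) by (field; exact hr).
  unfold T; rewrite nome_theta_add1 by apply Im_half; ring.
Qed.

Lemma th2_add_sub (x y : C) :
  th2 K K' lam (x + y) * th2 K K' lam (x - y) * th2 K K' lam 0 ^ 2
  = th2 K K' lam x ^ 2 * th2 K K' lam y ^ 2
    - th1 K K' lam x ^ 2 * th1 K K' lam y ^ 2.
Proof.
  pose proof (th1_add_sub (x + r_par K' lam) y) as H.
  rewrite th2_shift2, <- (th2_shift x) in H.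
  replace (x + r_par K' lam + y) with (x + y + r_par K' lam) in H by ring.
  replace (x + r_par K' lam - y) with (x - y + r_par K' lam) in H by ring.
  rewrite <- !th2_shift in H; rewrite H; ring.
Qed.

(** Source of [theta_1 (2)]: at [x = y] the formula [th1_add_sub] degenerates to [0 = 0], since
    [theta_1] is odd. *)
Lemma th12_add_sub (x y : C) :
  th1 K K' lam y * th2 K K' lam y
  * (th1 K K' lam (x - y) * th2 K K' lam (x + y)
     + th2 K K' lam (x - y) * th1 K K' lam (x + y))
  = th2 K K' lam 0 * th1 K K' lam (2 * y) * th1 K K' lam x * th2 K K' lam x.
Proof.
  rewrite !th1_nome, !th2_nome.
  set (X := x / (2 * r_par K' lam)); set (Y := y / (2 * r_par K' lam)).
  replace ((x + y) / (2 * r_par K' lam)) with (X + Y)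
    by (unfold X, Y; field; exact hr).
  replace ((x - y) / (2 * r_par K' lam)) with (X - Y)
    by (unfold X, Y; field; exact hr).
  replace (2 * y / (2 * r_par K' lam)) with (2 * Y)
    by (unfold Y; field; exact hr).
  replace (0 / (2 * r_par K' lam) + 1 / 2) with (1 / 2) by (field; exact hr).
  (* Every point carries an offset [1 / 4]: sums acquire a half period and differences none, so each
     pair is a product of one [theta_1] and one [theta_2], up to sign. *)
  pose proof (theta_three_term _ Im_half (X + 1 / 4) (Y + 1 / 4) (1 / 4)
                (1 / 4 - Y)) as H.
  unfold theta_pair in H.
  replace (X + 1 / 4 + (Y + 1 / 4)) with (X + Y + 1 / 2) in H by field.
  replace (X + 1 / 4 - (Y + 1 / 4)) with (X - Y) in H by field.
  replace (1 / 4 + (1 / 4 - Y)) with (- (Y - 1 / 2)) in H by field.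
  replace (1 / 4 - (1 / 4 - Y)) with Y in H by field.
  replace (X + 1 / 4 + 1 / 4) with (X + 1 / 2) in H by field.
  replace (X + 1 / 4 - 1 / 4) with X in H by field.
  replace (Y + 1 / 4 + (1 / 4 - Y)) with (1 / 2) in H by field.
  replace (Y + 1 / 4 - (1 / 4 - Y)) with (2 * Y) in H by field.
  replace (X + 1 / 4 + (1 / 4 - Y)) with (X - Y + 1 / 2) in H by field.
  replace (X + 1 / 4 - (1 / 4 - Y)) with (X + Y) in H by field.
  replace (Y + 1 / 4 + 1 / 4) with (Y + 1 / 2) in H by field.
  replace (Y + 1 / 4 - 1 / 4) with Y in H by field.
  rewrite nome_theta_opp in H by apply Im_half.
  fold (T (Y - 1 / 2)) in H; rewrite T_sub_half in H.
  fold (T (X + Y + 1 / 2)) (T (X - Y)) (T Y) (T (X + 1 / 2)) (T X) (T (1 / 2))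
    (T (2 * Y)) (T (X - Y + 1 / 2)) (T (X + Y)) (T (Y + 1 / 2)) in H.
  transitivity (c ^ 4 * (T (X + Y + 1 / 2) * T (X - Y) * (- - T (Y + 1 / 2) * T Y)
    - T (X + 1 / 2) * T X * (T (1 / 2) * T (2 * Y))
    + T (X - Y + 1 / 2) * T (X + Y) * (T (Y + 1 / 2) * T Y))
    + c * T (1 / 2) * (c * T (2 * Y)) * (c * T X) * (c * T (X + 1 / 2)));
    [ring | rewrite H; ring].
Qed.

End Theta_relations.

(** * The fused matrix *)

Definition spin_opp (a : spin) : spin := match a with vp => vm | vm => vp end.

(** The eight-vertex weights couple a spin pair only to itself and to its double flip, so two of the
    four terms of [act] survive. The trivial updates in [same] keep the shape of those terms. *)
Definition act8 (a b c d : C) (i j : site) (v : tensor) : tensor := fun s =>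
  let same := v (upd (upd s i (s i)) j (s j)) in
  let flipped := v (upd (upd s i (spin_opp (s i))) j (spin_opp (s j))) in
  match s i, s j with
  | vp, vp | vm, vm => a * same + d * flipped
  | _, _ => b * same + c * flipped
  end.

Lemma act_Rmat (K K' lam u : C) (i j : site) (v : tensor) :
  act (Rmat K K' lam u) i j v
  = fun s => Defs.R0 K K' lam u
      * act8 (Ra K K' lam u) (Rb K K' lam u) (Rc K K' lam u) (Rd K K' lam u)
             i j v s.
Proof.
  apply functional_extensionality; intros s.
  unfold act, act8, Rmat, sum_spin.
  destruct (s i), (s j);
    cbn [pair_index spin_index Nat.mul Nat.add];
    rewrite !coeff_mat_bij by lia;
    cbv [coeff_mat Rbar_mat fst snd List.nth mk_Tn spin_opp]; simpl; ring.
Qed.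

Lemma act8_scal (a b c d k : C) (i j : site) (v : tensor) :
  act8 a b c d i j (fun s => k * v s) = fun s => k * act8 a b c d i j v s.
Proof.
  apply functional_extensionality; intros s; unfold act8.
  destruct (s i), (s j); ring.
Qed.

Lemma Proj_scal (k : C) (i j : site) (v : tensor) :
  Proj i j (fun s => k * v s) = fun s => k * Proj i j v s.
Proof.
  apply functional_extensionality; intros s; unfold Proj, flip; ring.
Qed.

(** [R22] with the scalar factors removed and the weights at [u + 1], [u], [u - 1] made variables;
    those at [u] enter both fused factors. *)
Definition fused8 (a1 b1 c1 d1 a0 b0 c0 d0 am bm cm dm : C) (v : tensor)
  : tensor :=
  Proj Defs.b1 b2 (Proj s1 s2
    (act8 a1 b1 c1 d1 s1 b2 (act8 a0 b0 c0 d0 s2 b2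
      (Proj s1 s2
        (act8 a0 b0 c0 d0 s1 Defs.b1 (act8 am bm cm dm s2 Defs.b1 v)))))).

Definition fused8R (K K' lam u : C) : tensor -> tensor :=
  fused8 (Ra K K' lam (u + 1)) (Rb K K' lam (u + 1)) (Rc K K' lam (u + 1))
         (Rd K K' lam (u + 1))
         (Ra K K' lam u) (Rb K K' lam u) (Rc K K' lam u) (Rd K K' lam u)
         (Ra K K' lam (u - 1)) (Rb K K' lam (u - 1)) (Rc K K' lam (u - 1))
         (Rd K K' lam (u - 1)).

Lemma R22_fused8 (K K' lam u : C) (v : tensor) (s : site -> spin) :
  R22 K K' lam u v s = R22_0 K K' lam u * fused8R K K' lam u v s.
Proof.
  unfold R22, R21, R22_0, R21_0, fused8R, fused8.
  replace (u - 1 + 1) with u by ring.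
  rewrite !act_Rmat.
  repeat (rewrite !act8_scal || rewrite !Proj_scal).
  ring.
Qed.

Definition spins (a b c d : spin) : site -> spin := fun i =>
  match i with s1 => a | s2 => b | Defs.b1 => c | b2 => d end.

Lemma spins_eta (s : site -> spin) :
  s = spins (s s1) (s s2) (s Defs.b1) (s b2).
Proof. apply functional_extensionality; intros []; reflexivity. Qed.

Definition sym_index (a b : spin) : nat := spin_index a + spin_index b.

(** The number of minus spins in each pair fixes its weight, so only one basis vector has a nonzero
    coordinate at a given configuration. *)
Lemma sum_sym_basis (m : nat -> C) (a b c d : spin) :
  sum_n (fun i => m i * sym_basis i (spins a b c d)) 8
  = m (3 * sym_index a b + sym_index c d)%nat
    * (sym_vec (nth (sym_index a b) (wt2 :: wt0 :: wtm2 :: nil) wt2) a b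
       * sym_vec (nth (sym_index c d) (wt2 :: wt0 :: wtm2 :: nil) wt2) c d).
Proof.
  rewrite !sum_Sn, sum_O; change plus with Cplus.
  match goal with |- @eq _ ?x ?y => change (@eq C x y) end.
  destruct a, b, c, d;
    cbv [sym_index spin_index sym_basis weight_pairs nth fst snd sym_vec spins
         Nat.mul Nat.add]; ring.
Qed.

Lemma Proj_Proj_spins (w : tensor) (a b c d : spin) :
  Proj Defs.b1 b2 (Proj s1 s2 w) (spins a b c d)
  = / 4 * (w (spins a b c d) + w (spins b a c d)
           + w (spins a b d c) + w (spins b a d c)).
Proof.
  cbv [Proj flip].
  rewrite (spins_eta (upd _ s2 _)),
    (spins_eta (upd (upd (spins a b c d) _ _) _ _)),
    (spins_eta (upd (upd (spins a b c d) s1 _) _ _)).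
  cbv [upd site_eq_dec site_rec site_rect spins].
  field.
Qed.

Lemma spins_sorted_ind (P : spin -> spin -> spin -> spin -> Prop) :
  (forall a b c d, P a b c d -> P b a c d) ->
  (forall a b c d, P a b c d -> P a b d c) ->
  (forall a b c d, (a, b) <> (vm, vp) -> (c, d) <> (vm, vp) -> P a b c d) ->
  forall a b c d, P a b c d.
Proof.
  intros S1 S2 H.
  assert (H' : forall a b c d, (a, b) <> (vm, vp) -> P a b c d).
  { intros a b [] [] Hab; try (apply H; [exact Hab | discriminate]).
    apply S2, H; [exact Hab | discriminate]. }
  intros [] [] c d; try (apply H'; discriminate).
  apply S1, H'; discriminate.
Qed.

(** [fused_mat] over arbitrary functions, so that theta values are atoms for [field]; [fused_mat] is
    recovered by conversion. *)
Definition fused_entries (t1 t2 f1 f2 : C -> C) : @matrix C 9 9 :=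
  let e ent := ent t1 t2 f1 f2 : C in
  let st ent := ent t1 t2 (fun k => - f2 k) f1 : C in
  let A := e entA in let As := st entA in
  let B := e entB in let Bs := st entB in
  let c := e entC in let cs := st entC in
  let D := e entD in
  let E := e entE in
  let F := e entF in
  let G := e entG in let Gs := st entG in
  let H := e entH in let Hs := st entH in
  let I := e entI in let Is := st entI in
  let o : C := 0 in
  [[G,  o,  A,  o,  B,  o,  A,  o,  H],
   [o,  F,  o,  c,  o,  cs, o,  D,  o],
   [As, o,  Gs, o,  Bs, o,  Hs, o,  As],
   [o,  c,  o,  F,  o,  D,  o,  cs, o],
   [I,  o,  Is, o,  E,  o,  Is, o,  I],
   [o,  cs, o,  D,  o,  F,  o,  c,  o],
   [As, o,  Hs, o,  Bs, o,  Gs, o,  As],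
   [o,  D,  o,  cs, o,  c,  o,  F,  o],
   [H,  o,  A,  o,  B,  o,  A,  o,  G]].

(* Eliminating f_i(2), f_i(-1) and t_i(2) leaves rational identities in
   f_i(0), f_i(1), t_i(1) and t2 0, which are independent variables. *)
Lemma fused8_sym_basis (t1 t2 f1 f2 : C -> C) :
  t2 0 <> 0 -> f1 0 <> 0 -> f2 0 <> 0 -> f1 1 <> 0 -> f2 1 <> 0 ->
  f1 2 <> 0 -> f2 2 <> 0 ->
  f1 2 = (f1 1 ^ 2 * t2 1 ^ 2 - f2 1 ^ 2 * t1 1 ^ 2) / (t2 0 ^ 2 * f1 0) ->
  f2 2 = (f2 1 ^ 2 * t2 1 ^ 2 - f1 1 ^ 2 * t1 1 ^ 2) / (t2 0 ^ 2 * f2 0) ->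
  f1 (- (1)) = (f1 0 ^ 2 * t2 1 ^ 2 - f2 0 ^ 2 * t1 1 ^ 2) / (t2 0 ^ 2 * f1 1) ->
  f2 (- (1)) = (f2 0 ^ 2 * t2 1 ^ 2 - f1 0 ^ 2 * t1 1 ^ 2) / (t2 0 ^ 2 * f2 1) ->
  t2 2 = (t2 1 ^ 4 - t1 1 ^ 4) / t2 0 ^ 3 ->
  t1 2 = t1 1 * t2 1 * (f2 1 ^ 2 * (f1 0 ^ 2 * t2 1 ^ 2 - f2 0 ^ 2 * t1 1 ^ 2)
                        + f1 1 ^ 2 * (f2 0 ^ 2 * t2 1 ^ 2 - f1 0 ^ 2 * t1 1 ^ 2))
         / (t2 0 ^ 3 * f1 0 * f2 0 * f1 1 * f2 1) ->
  forall (j : nat) (s : site -> spin), (j < 9)%nat ->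
  fused8 (t2 1 * f2 1 / (t2 0 * f2 2)) (t2 1 * f1 1 / (t2 0 * f1 2))
         (t1 1 * f2 1 / (t2 0 * f1 2)) (- (t1 1 * f1 1 / (t2 0 * f2 2)))
         (t2 1 * f2 0 / (t2 0 * f2 1)) (t2 1 * f1 0 / (t2 0 * f1 1))
         (t1 1 * f2 0 / (t2 0 * f1 1)) (- (t1 1 * f1 0 / (t2 0 * f2 1)))
         (t2 1 * f2 (- (1)) / (t2 0 * f2 0)) (t2 1 * f1 (- (1)) / (t2 0 * f1 0))
         (t1 1 * f2 (- (1)) / (t2 0 * f1 0))
         (- (t1 1 * f1 (- (1)) / (t2 0 * f2 0)))
         (sym_basis j) s
  = sum_n (fun i => coeff_mat (0 : C) (fused_entries t1 t2 f1 f2) i j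
                    * sym_basis i s) 8.
Proof.
  intros HZ Hp0 Hq0 Hp1 Hq1 Hp2 Hq2 E1 E2 E3 E4 E5 E6 j s Hj.
  rewrite (spins_eta s), sum_sym_basis.
  (* Eliminating [f1 2] and [f2 2] puts these numerators into denominators; the squares are grouped
     to match the side conditions of [field]. *)
  assert (N1 : (f1 1 * t2 1) ^ 2 - (f2 1 * t1 1) ^ 2 <> 0).
  { intros E; apply Hp2; rewrite E1.
    replace (f1 1 ^ 2 * t2 1 ^ 2 - f2 1 ^ 2 * t1 1 ^ 2) with
      ((f1 1 * t2 1) ^ 2 - (f2 1 * t1 1) ^ 2) by ring.
    rewrite E; unfold Cdiv; ring. }
  assert (N2 : (f2 1 * t2 1) ^ 2 - (f1 1 * t1 1) ^ 2 <> 0).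
  { intros E; apply Hq2; rewrite E2.
    replace (f2 1 ^ 2 * t2 1 ^ 2 - f1 1 ^ 2 * t1 1 ^ 2) with
      ((f2 1 * t2 1) ^ 2 - (f1 1 * t1 1) ^ 2) by ring.
    rewrite E; unfold Cdiv; ring. }
  generalize (s s1) (s s2) (s Defs.b1) (s b2); clear s.
  (* Symmetric tensors: three of the four spin pairs suffice. *)
  apply spins_sorted_ind.
  - intros a b c d E; unfold fused8 in E |- *.
    rewrite Proj_Proj_spins in E |- *.
    replace (sym_index b a) with (sym_index a b) by apply Nat.add_comm.
    replace (sym_vec _ b a) with
      (sym_vec (nth (sym_index a b) (wt2 :: wt0 :: wtm2 :: nil) wt2) a b)
      by (destruct a, b; reflexivity).
    rewrite <- E; ring.
  - intros a b c d E; unfold fused8 in E |- *.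
    rewrite Proj_Proj_spins in E |- *.
    replace (sym_index d c) with (sym_index c d) by apply Nat.add_comm.
    replace (sym_vec _ d c) with
      (sym_vec (nth (sym_index c d) (wt2 :: wt0 :: wtm2 :: nil) wt2) c d)
      by (destruct c, d; reflexivity).
    rewrite <- E; ring.
  - intros a b c d Hab Hcd.
    (* Nine columns by nine sorted configurations; where the matrix entry is 0 by parity, no
       elimination takes place. *)
    do 9 (destruct j as [|j]; [
      destruct a, b; try (exfalso; apply Hab; reflexivity);
      destruct c, d; try (exfalso; apply Hcd; reflexivity);
      cbv [fused8 Proj flip act8 upd site_eq_dec site_rec site_rect sym_basis
           weight_pairs nth fst snd sym_vec spin_opp spins sym_index spin_index
           Nat.mul Nat.add coeff_mat fused_entries coeff_Tn
           entA entB entC entD entE entF entG entH entI cmul];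
      match goal with
      | |- _ = RtoC 0 * _ => ring
      | _ => rewrite ?E1, ?E2, ?E3, ?E4, ?E5, ?E6;
             field; repeat split; assumption
      end | ]).
    lia.
Qed.

(** The product of the inverse factors converges as well. If [qprod q z] were 0, the termwise
    product of the two, which is constantly 1, would tend to 0. *)
Lemma qprod_neq_0 (q z : C) :
  (Cmod q < 1)%R -> (Cmod z < 1)%R -> qprod q z <> 0.
Proof.
  intros Hq Hz E.
  destruct (qprod_cv q z Hq) as [Hf _]; rewrite E in Hf.
  assert (Hb : forall n, (1 - Cmod z <= Cmod (1 - z * q ^ n))%R).
  { intros n.
    pose proof (Cmod_triangle (1 - z * q ^ n) (z * q ^ n)) as H.
    replace (1 - z * q ^ n + z * q ^ n) with (RtoC 1) in H by ring.
    rewrite Cmod_1, Cmod_mult, Cmod_pow in H.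
    assert (Hp : (Cmod q ^ n <= 1)%R).
    { rewrite <- (pow1 n); apply pow_incr; pose proof (Cmod_ge_0 q); lra. }
    pose proof (Cmod_ge_0 z); nra. }
  assert (Hn : forall n, 1 - z * q ^ n <> 0).
  { intros n H; specialize (Hb n); rewrite H, Cmod_0 in Hb; lra. }
  assert (Hg : prod_to (fun n => / (1 - z * q ^ n))
                       (Cinfprod (fun n => / (1 - z * q ^ n)))).
  { apply (Cprod_geom_cv _ (Cmod z / (1 - Cmod z)) (Cmod q)).
    - split; [apply Cmod_ge_0 | exact Hq].
    - apply Rdiv_le_0_compat; [apply Cmod_ge_0 | lra].
    - intros n.
      replace (/ (1 - z * q ^ n) - 1) with (z * q ^ n / (1 - z * q ^ n))
        by (field; apply Hn).
      rewrite Cmod_div, Cmod_mult, Cmod_pow by apply Hn.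
      replace (Cmod z / (1 - Cmod z) * Cmod q ^ n)%R with
        (Cmod z * Cmod q ^ n / (1 - Cmod z))%R by (field; lra).
      apply Rmult_le_compat_l.
      + apply Rmult_le_pos; [apply Cmod_ge_0 | apply pow_le, Cmod_ge_0].
      + apply Rinv_le_contravar; [lra | apply Hb]. }
  pose proof (prod_to_mult _ _ _ _ Hf Hg) as H.
  assert (H1 : prod_to (fun n => (1 - z * q ^ n) * / (1 - z * q ^ n)) 1).
  { apply is_lim_seq_ext with (fun _ => 0%R); [|apply is_lim_seq_const].
    intros N; rewrite (Cprod_ext _ (fun _ => 1)).
    - replace (Cprod (fun _ => 1) N) with (RtoC 1).
      + replace (1 - 1) with (RtoC 0) by ring; symmetry; apply Cmod_0.
      + induction N as [|N IH]; simpl; [|rewrite <- IH]; ring.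
    - intros n; field; apply Hn. }
  apply C1_nz; rewrite (prod_to_unique _ _ _ H1 H); ring.
Qed.

Lemma th2_0_neq_0 (K K' lam : C) :
  (0 < Im (tau K K'))%R -> th2 K K' lam 0 <> 0.
Proof.
  intros Ht.
  pose proof (Im_half K K' Ht) as Hh.
  pose proof (Cmod_cis_lt_1 _ Hh) as Hq.
  assert (Hp : forall z, (Cmod z < 1)%R -> qprod (cis (tau K K' / 2)) z <> 0)
    by (intros; apply qprod_neq_0; assumption).
  rewrite th2_nome by exact Ht.
  replace (0 / (2 * r_par K' lam) + 1 / 2) with (1 / 2)
    by (unfold Cdiv; ring).
  unfold nome_theta, jtheta, vartheta1_const.
  rewrite cis_half.
  set (q := cis (tau K K' / 2)) in *.
  assert (Hmq : (Cmod (q / - (1)) < 1)%R).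
  { replace (q / - (1)) with (- q) by field; rewrite Cmod_opp; exact Hq. }
  repeat apply Cmult_neq_0; auto using Ci_neq_0, Cexp_neq_0, cis_neq_0.
  - replace (Cinfprod (fun n => 1 - q ^ (n + 1))) with (qprod q q); [auto|].
    unfold qprod; f_equal; apply functional_extensionality; intros n.
    rewrite Nat.add_1_r, Cpow_S; reflexivity.
  (* The argument [- (1)] lies on the unit circle, outside the range of [qprod_neq_0]; splitting off
     its first factor, 2, leaves the argument [- q]. *)
  - rewrite qprod_step by exact Hq; apply Cmult_neq_0.
    + replace (1 - - (1)) with (RtoC 2) by ring; apply C2_neq_0.
    + replace (- (1) * q) with (q / - (1)) by field; auto.
Qed.

Lemma fused8R_sym_basis (K K' lam u : C) (j : nat) (s : site -> spin) :
  (0 < Im (tau K K'))%R -> r_par K' lam <> 0 ->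
  (forall k, In k (0 :: 1 :: 2 :: nil) ->
     th1 K K' lam (u + k) <> 0 /\ th2 K K' lam (u + k) <> 0) ->
  (j < 9)%nat ->
  fused8R K K' lam u (sym_basis j) s
  = sum_n (fun i => coeff_mat (0 : C) (fused_mat K K' lam u) i j
                    * sym_basis i s) 8.
Proof.
  intros Ht Hr HN Hj.
  pose proof (th2_0_neq_0 K K' lam Ht) as HZ.
  destruct (HN 0 ltac:(simpl; auto)) as [Np0 Nq0].
  destruct (HN 1 ltac:(simpl; auto)) as [Np1 Nq1].
  destruct (HN 2 ltac:(simpl; auto)) as [Np2 Nq2].
  set (t1 := th1 K K' lam) in *; set (t2 := th2 K K' lam) in *.
  (* [A1] and [A2] give the values at [u + 2], [A3] and [A4] those at [u - 1], [A5] gives [t2 2],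
     and [A6] gives [t1 2]. The form [u + 0] is what [f1 0] and [f2 0] unfold to. *)
  pose proof (th1_add_sub K K' lam Ht Hr (u + 1) 1) as A1.
  pose proof (th2_add_sub K K' lam Ht Hr (u + 1) 1) as A2.
  pose proof (th1_add_sub K K' lam Ht Hr (u + 0) 1) as A3.
  pose proof (th2_add_sub K K' lam Ht Hr (u + 0) 1) as A4.
  pose proof (th2_add_sub K K' lam Ht Hr 1 1) as A5.
  pose proof (th12_add_sub K K' lam Ht Hr (u + 0) 1) as A6.
  fold t1 t2 in A1, A2, A3, A4, A5, A6.
  replace (u + 1 + 1) with (u + 2) in A1, A2 by ring.
  replace (u + 1 - 1) with (u + 0) in A1, A2 by ring.
  replace (u + 0 + 1) with (u + 1) in A3, A4, A6 by ring.
  replace (u + 0 - 1) with (u + - (1)) in A3, A4, A6 by ring.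
  replace (1 + 1) with (RtoC 2) in A5 by ring.
  replace (1 - 1) with (RtoC 0) in A5 by ring.
  replace (2 * 1) with (RtoC 2) in A6 by ring.
  assert (E3 : t1 (u + - (1)) = (t1 (u + 0) ^ 2 * t2 1 ^ 2
    - t2 (u + 0) ^ 2 * t1 1 ^ 2) / (t2 0 ^ 2 * t1 (u + 1)))
    by (rewrite <- A3; field; auto).
  assert (E4 : t2 (u + - (1)) = (t2 (u + 0) ^ 2 * t2 1 ^ 2
    - t1 (u + 0) ^ 2 * t1 1 ^ 2) / (t2 0 ^ 2 * t2 (u + 1)))
    by (rewrite <- A4; field; auto).
  pose proof (fused8_sym_basis t1 t2 (fun k => t1 (u + k)) (fun k => t2 (u + k))
    HZ Np0 Nq0 Np1 Nq1 Np2 Nq2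
    ltac:(cbv beta; rewrite <- A1; field; auto)
    ltac:(cbv beta; rewrite <- A2; field; auto)
    E3 E4
    ltac:(transitivity (t2 2 * t2 0 * t2 0 ^ 2 / t2 0 ^ 3);
          [field; auto | rewrite A5; f_equal; ring])
    ltac:(cbv beta;
          transitivity (t2 0 * t1 2 * t1 (u + 0) * t2 (u + 0)
                        / (t2 0 * t1 (u + 0) * t2 (u + 0)));
          [field; auto | rewrite <- A6, E3, E4; field; auto]) j s Hj) as M.
  cbv beta in M.
  unfold fused8R, Ra, Rb, Rc, Rd; fold t1 t2.
  replace (1 + (u + 1)) with (u + 2) by ring.
  replace (1 + (u - 1)) with (u + 0) by ring.
  replace (1 + u) with (u + 1) by ring.
  replace (u - 1) with (u + - (1)) by ring.
  replace (t1 u) with (t1 (u + 0)) by (f_equal; ring).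
  replace (t2 u) with (t2 (u + 0)) by (f_equal; ring).
  exact M.
Qed.

(* The hypotheses on tau and x force K, K' and lam to be nonzero.  The identity
   of meromorphic functions of u is stated at every u at which no denominator
   occurring in either side vanishes. *)
Theorem proposition2p2 (K K' lam u : C)
  (htau : (0 < Im (tau K K'))%R)
  (hx : (Cmod (xpow K lam 1) < 1)%R)
  (hreg_m1 : R_regular K K' lam (u - 1))
  (hreg_0 : R_regular K K' lam u)
  (hreg_p1 : R_regular K K' lam (u + 1))
  (hbr : br K K' lam (u - 1) <> 0) :
  R22_0 K K' lam u = br K K' lam (u + 1) / br K K' lam (u - 1) /\
  has_sym_matrix (R22 K K' lam u) (R22_0 K K' lam u) (fused_mat K K' lam u).
Proof.
  destruct hreg_m1 as [am [bm dm]], hreg_0 as [a0 [b0 d0]],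
    hreg_p1 as [a1 [b1 d1]].
  split; [apply R22_0_br; assumption|].
  pose proof (r_par_neq_0 K K' lam htau hx) as Hr.
  intros j Hj s; rewrite R22_fused8, fused8R_sym_basis; auto.
  - rewrite <- (sum_n_mult_l (K := C_Ring)); apply sum_n_ext; intros i.
    apply Cmult_assoc.
  - replace (1 + (u - 1)) with (u + 0) in am, bm by ring.
    replace (1 + u) with (u + 1) in a0, b0 by ring.
    replace (1 + (u + 1)) with (u + 2) in a1, b1 by ring.
    intros k [<- | [<- | [<- | []]]]; auto.
Qed.
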